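(* Let $0<r_i<r_e$, let $D=\{x\in\mathbb{R}^2:|x|<r_i\}$ and $\Omega=\{x\in\mathbb{R}^2:|x|<r_e\}$ be concentric disks, let $n\ge 1$ be an integer, and, in polar coordinates $(r,\theta)$, let $H(x)=r^n e^{\mathrm{i}n\theta}$ and $P(x)=12\,r^n e^{\mathrm{i}n\theta}$. Let $(\varphi,p)$ be the solution of the electro-osmotic system (given in the context) with data $D,\Omega,H,P$ and zeta potential $\zeta_0\in\mathbb{R}$. (1) If $$\zeta_0=\frac{2r_i^{2n}r_e^{2n}}{r_e^{4n}-r_i^{4n}},$$ then the perfect hydrodynamic cloaking condition $\boldsymbol{u}_{aver}=-\nabla P/12$ in $\mathbb{R}^2\setminus\overline{\Omega}$ is satisfied. (2) If $$\zeta_0=\frac{2r_e^{2n}}{r_e^{2n}-r_i^{2n}},$$ then the perfect hydrodynamic shielding condition $\boldsymbol{F}=0$ is satisfied.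
   Context: Electro-osmotic system: given a bounded domain $\Omega\subset\mathbb{R}^2$, a domain $D$ with $\overline D\subset\Omega$ (both of class $C^{1,\alpha}$ for some $0<\alpha<1$), harmonic functions $H,P$ on $\mathbb{R}^2$ (background electrostatic potential and pressure, here allowed complex-valued) and a constant $\zeta_0\in\mathbb{R}$, the electrostatic potential $\varphi$ and the pressure $p$ satisfy $$\Delta\varphi=0\ \text{in }\mathbb{R}^2\setminus\overline D,\qquad \frac{\partial\varphi}{\partial\nu}=0\ \text{on }\partial D,\qquad \varphi=H(x)+O(|x|^{-1})\ \text{as }|x|\to\infty,$$ $$\Delta p=0\ \text{in }(\mathbb{R}^2\setminus\overline D)\setminus\partial\Omega,\qquad \frac{\partial p}{\partial\nu}=0\ \text{on }\partial D,\qquad p|_+=p|_-\ \text{on }\partial\Omega,$$ $$\frac{\partial p}{\partial\nu}\Big|_+-\frac{\partial p}{\partial\nu}\Big|_-=12\zeta_0\frac{\partial\varphi}{\partial\nu}\ \text{on }\partial\Omega,\qquad p=P(x)+O(|x|^{-1})\ \text{as }|x|\to\infty.$$ Here $\nu$ is the outward unit normal, and for $x\in\partial\Omega$, $\frac{\partial p}{\partial\nu}\big|_\pm(x)=\lim_{t\to0^+}\langle\nabla p(x\pm t\nu(x)),\nu(x)\rangle$; $p|_\pm$ denotes the trace from outside ($+$) or inside ($-$) $\Omega$. The zeta potential distribution is $\zeta_{mean}=\zeta_0$ in $\Omega\setminus\overline D$ and $\zeta_{mean}=0$ in $\mathbb{R}^2\setminus\overline\Omega$. The depth-averaged velocity is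 $\boldsymbol{u}_{aver}=-\frac1{12}\nabla p-\zeta_{mean}\nabla\varphi$. The depth-averaged hydrodynamic force on the object is $\boldsymbol F=\int_{\partial D}\boldsymbol\sigma\cdot\nu\,ds$ with $\boldsymbol\sigma=-pI$ ($I$ the identity matrix). The triple $\{D,\Omega;\zeta_0\}$ is a perfect hydrodynamic cloaking if $\boldsymbol u_{aver}=-\nabla P/12$ in $\mathbb{R}^2\setminus\overline\Omega$, and a perfect hydrodynamic shielding if $\boldsymbol F=0$. *)

(* Defs.v *)
From Stdlib Require Import Reals ClassicalEpsilon.
From Coquelicot Require Export Coquelicot.
Open Scope R_scope.

(** Points of the plane are pairs in [R * R]; [enorm] is the Euclidean norm. *)
Definition dot (x y : R * R) : R := fst x * fst y + snd x * snd y.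
Definition enorm (x : R * R) : R := sqrt (dot x x).
Definition vopp (x : R * R) : R * R := (- fst x, - snd x).
Definition vsub (x y : R * R) : R * R := (fst x - fst y, snd x - snd y).
Definition along (x : R * R) (t : R) (d : R * R) : R * R :=
  (fst x + t * fst d, snd x + t * snd d).

Definition polar (r th : R) : R * R := (r * cos th, r * sin th).
Definition expi (t : R) : C := (cos t, sin t).

Definition disk (r : R) (x : R * R) : Prop := enorm x < r.

Definition closure (U : R * R -> Prop) (x : R * R) : Prop :=
  forall V : R * R -> Prop, locally x V -> exists y, V y /\ U y.
Definition boundary (U : R * R -> Prop) (x : R * R) : Prop :=
  closure U x /\ closure (fun y => ~ U y) x.
Definition exterior (U : R * R -> Prop) (x : R * R) : Prop := ~ closure U x.

(** [v] is the outward unit normal of [U] at [x]: near [x], the set [U] contains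
    every cone opening along [- v] and is disjoint from every cone opening along
    [v]. For a domain of class C^1 this is the usual normal at a boundary point. *)
Definition outward_normal (U : R * R -> Prop) (x v : R * R) : Prop :=
  enorm v = 1 /\
  forall eps : R, 0 < eps ->
    locally x (fun y =>
      (dot (vsub y x) v < - eps * enorm (vsub y x) -> U y) /\
      (dot (vsub y x) v > eps * enorm (vsub y x) -> ~ U y)).

(** Partial derivatives of complex-valued functions of two real variables.
    [Derive] is total, so statements using them assert differentiability too. *)
Definition d1 (u : R * R -> C) (x : R * R) : C :=
  (Derive (fun s => Re (u (s, snd x))) (fst x),
   Derive (fun s => Im (u (s, snd x))) (fst x)).
Definition d2 (u : R * R -> C) (x : R * R) : C :=
  (Derive (fun s => Re (u (fst x, s))) (snd x),
   Derive (fun s => Im (u (fst x, s))) (snd x)).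

Definition grad (u : R * R -> C) (x : R * R) : C * C := (d1 u x, d2 u x).

(** The bilinear product of a complex vector with a real direction. *)
Definition cdot (w : C * C) (v : R * R) : C :=
  (fst w * RtoC (fst v) + snd w * RtoC (snd v))%C.

Definition C1_on (U : R * R -> Prop) (u : R * R -> C) : Prop :=
  forall x, U x ->
    ex_derive (V := C_R_NormedModule) (fun s => u (s, snd x)) (fst x) /\
    ex_derive (V := C_R_NormedModule) (fun s => u (fst x, s)) (snd x) /\
    continuous (d1 u) x /\ continuous (d2 u) x.

Definition C2_on (U : R * R -> Prop) (u : R * R -> C) : Prop :=
  C1_on U u /\ C1_on U (d1 u) /\ C1_on U (d2 u).

Definition laplacian (u : R * R -> C) (x : R * R) : C :=
  (d1 (d1 u) x + d2 (d2 u) x)%C.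

Definition harmonic_on (U : R * R -> Prop) (u : R * R -> C) : Prop :=
  C2_on U u /\ forall x, U x -> laplacian u x = RtoC 0.

(** For [u] of class C^1 in the open set [U]: [u] and its gradient extend
    continuously to the closure of [U]. *)
Definition C1_up_to_boundary (U : R * R -> Prop) (u : R * R -> C) : Prop :=
  forall x, boundary U x ->
    exists l l1 l2 : C,
      filterlim u (within U (locally x)) (locally l) /\
      filterlim (d1 u) (within U (locally x)) (locally l1) /\
      filterlim (d2 u) (within U (locally x)) (locally l2).

(** [f (x + t d)] tends to [l] as [t] tends to [0+]. With [d] the outward normal
    this is the exterior limit [f|_+], with its opposite the interior one [f|_-]. *)
Definition side_limit (f : R * R -> C) (x d : R * R) (l : C) : Prop :=
  filterlim (fun t : R => f (along x t d)) (at_right 0) (locally l).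

Definition dnu (u : R * R -> C) (v x : R * R) : C := cdot (grad u x) v.

Definition asymptotic_to (u v : R * R -> C) : Prop :=
  exists M R0 : R, 0 < R0 /\
    forall x, R0 <= enorm x -> Cmod (u x - v x)%C <= M / enorm x.

(** [(phi, p)] is a (classical) solution of the electro-osmotic system. The
    solution is sought in the class of functions that are C^1 up to the boundary
    on each side of the interfaces: without a regularity class the one-sided
    limits along normals would not determine the solution. *)
Record electroosmotic_solution (D Omega : R * R -> Prop) (H P : R * R -> C)
    (zeta0 : R) (phi p : R * R -> C) : Prop := {
  phi_harmonic : harmonic_on (exterior D) phi;
  phi_regular : C1_up_to_boundary (exterior D) phi;
  phi_neumann : forall x v, boundary D x -> outward_normal D x v ->
    side_limit (dnu phi v) x v (RtoC 0);
  phi_infinity : asymptotic_to phi H;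
  p_harmonic : harmonic_on (fun x => exterior D x /\ ~ boundary Omega x) p;
  p_regular_in : C1_up_to_boundary (fun x => Omega x /\ exterior D x) p;
  p_regular_out : C1_up_to_boundary (exterior Omega) p;
  p_neumann : forall x v, boundary D x -> outward_normal D x v ->
    side_limit (dnu p v) x v (RtoC 0);
  p_continuity : forall x v, boundary Omega x -> outward_normal Omega x v ->
    exists l : C, side_limit p x v l /\ side_limit p x (vopp v) l;
  p_jump : forall x v, boundary Omega x -> outward_normal Omega x v ->
    exists lplus lminus : C,
      side_limit (dnu p v) x v lplus /\
      side_limit (dnu p v) x (vopp v) lminus /\
      (lplus - lminus)%C = (RtoC (12 * zeta0) * dnu phi v x)%C;
  p_infinity : asymptotic_to p P
}.

(** The distribution is immaterial on the boundary of [Omega] and on the closure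
    of [D]; the value there is a convention. *)
Definition zeta_mean (D Omega : R * R -> Prop) (zeta0 : R) (x : R * R) : R :=
  if excluded_middle_informative (Omega x /\ exterior D x) then zeta0 else 0.

Definition u_aver (D Omega : R * R -> Prop) (zeta0 : R) (phi p : R * R -> C)
    (x : R * R) : C * C :=
  ((RtoC (- (1 / 12)) * d1 p x - RtoC (zeta_mean D Omega zeta0 x) * d1 phi x)%C,
   (RtoC (- (1 / 12)) * d2 p x - RtoC (zeta_mean D Omega zeta0 x) * d2 phi x)%C).

(** [(phi, p)] is meant to be the solution of the electro-osmotic system. *)
Definition perfect_hydrodynamic_cloaking (D Omega : R * R -> Prop) (zeta0 : R)
    (P phi p : R * R -> C) : Prop :=
  forall x, exterior Omega x ->
    u_aver D Omega zeta0 phi p x =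
      ((- d1 P x / RtoC 12)%C, (- d2 P x / RtoC 12)%C).

(** [gamma] is a simple closed curve of class C^1 and length [L], with image the
    boundary of [D], parametrized by arc length and extended periodically. *)
Definition arclength_parametrization (D : R * R -> Prop) (gamma : R -> R * R)
    (L : R) : Prop :=
  0 < L /\
  (exists tau : R -> R * R, forall s,
     is_derive gamma s (tau s) /\ continuous tau s /\ enorm (tau s) = 1) /\
  (forall s, gamma (s + L) = gamma s) /\
  (forall s t, 0 <= s < L -> 0 <= t < L -> gamma s = gamma t -> s = t) /\
  (forall x, boundary D x <-> exists s, 0 <= s < L /\ gamma s = x).

(** The 2 x 2 stress tensor [- q I], by rows, and its action on a normal. *)
Definition stress (q : C) : (C * C) * (C * C) :=
  ((- q, RtoC 0), (RtoC 0, - q))%C.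
Definition traction (sigma : (C * C) * (C * C)) (v : R * R) : C * C :=
  (cdot (fst sigma) v, cdot (snd sigma) v).

(** [F] is the integral of [sigma . nu] over the boundary of [D] with respect to
    arc length, [pb] being the trace of [p] on that boundary from outside [D]. *)
Definition is_hydrodynamic_force (D : R * R -> Prop) (p : R * R -> C)
    (F : C * C) : Prop :=
  exists (gamma : R -> R * R) (L : R) (nu : R * R -> R * R) (pb : R * R -> C),
    arclength_parametrization D gamma L /\
    (forall x, boundary D x ->
       outward_normal D x (nu x) /\ side_limit p x (nu x) (pb x)) /\
    let f s := traction (stress (pb (gamma s))) (nu (gamma s)) in
    is_RInt (V := C_R_NormedModule) (fun s => fst (f s)) 0 L (fst F) /\
    is_RInt (V := C_R_NormedModule) (fun s => snd (f s)) 0 L (snd F).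

Definition perfect_hydrodynamic_shielding (D : R * R -> Prop) (p : R * R -> C)
    : Prop :=
  is_hydrodynamic_force D p (RtoC 0, RtoC 0).

(* Main.v *)
(** Write [u = Re] or [Im] of a potential in polar coordinates and let
    [E r] be the integral of [u^2] over the angle. Laplace's equation and an
    integration by parts in the angle show that [r E'(r) / 2], the integral of
    [u (r u_r)], is nondecreasing in [r]. If [u] solves the homogeneous problem,
    this flux tends to 0 at [ri] and, like [E], is continuous across [re], so [E]
    is nondecreasing; as [u = O(1/r)], [E] tends to 0 at infinity, hence [u = 0].
    Subtracting the explicit separated solutions of the form
    [(A r^n + B r^-n) cos (n t - d)] therefore identifies [phi] and [p]. The
    pressure turns out to be [12 r^n + c_out r^-n] (times [e^(i n t)]) outside and
    [c_in (r^n + ri^(2n) r^-n)] inside [re]; cloaking is [c_out = 0], and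
    shielding follows from [c_in = 0]. *)
Require Import Defs.
From Stdlib Require Import Reals Lra Lia ClassicalEpsilon.
From Coquelicot Require Import Coquelicot.
(* Stdlib's Reals also exports projections named [d1] and [d2]. *)
Import Defs.
Open Scope R_scope.

(** No solution is constructed: [hsol] supplies an arbitrary one, and everything rests on showing
    that it has the explicit form. The obstacle is that the boundary conditions hold only as limits
    along normals and nothing is known of [p] on the circles themselves. Continuity of energy and
    flux across [re] therefore becomes an estimate between two nearby radii; it comes from the joint
    limits granted by the regularity class, made uniform in the angle by compactness. The flux jump
    of [p] is inhomogeneous but involves only [phi]: once the radial derivative of [phi] at [re] is
    known, [p] and the separated solution have the same jump, and their difference solves the
    homogeneous problem. With [rho = ri^(2n)] and [s = re^(2n)], the equation [c_in = 0] reads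
    [zeta0 = 2 s / (s - rho)] and [c_out = 0] reads [zeta0 = 2 rho s / (s^2 - rho^2)]; these are the
    two values of the theorem. *)

(** * Calculus on a segment: monotonicity, compactness, vanishing integrals *)

Lemma nondecreasing_of_derive (f df : R -> R) (x y : R) :
  x <= y ->
  (forall z, x <= z <= y -> is_derive f z (df z)) ->
  (forall z, x <= z <= y -> 0 <= df z) ->
  f x <= f y.
Proof.
  intros hxy hd h0.
  destruct (MVT_gen f x y df) as [c [hc e]].
  - intros z hz. rewrite Rmin_left, Rmax_right in hz by lra. apply hd; lra.
  - intros z hz. rewrite Rmin_left, Rmax_right in hz by lra.
    apply continuity_pt_filterlim, (ex_derive_continuous (V := R_NormedModule)).
    exists (df z). now apply hd.
  - rewrite Rmin_left, Rmax_right in hc by lra.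
    assert (0 <= df c * (y - x)) by (apply Rmult_le_pos; [now apply h0 | lra]).
    lra.
Qed.

(** Compactness of [[a, b]]. It makes limits known near each angle uniform over a full turn, so that
    they pass under the integral. *)
Lemma uniform_on_segment (Q : R -> R -> Prop) (a b : R) :
  (forall d d' t, d' <= d -> Q d t -> Q d' t) ->
  (forall t0, exists d, 0 < d /\ forall t, Rabs (t - t0) < d -> Q d t) ->
  exists d, 0 < d /\ forall t, a <= t <= b -> Q d t.
Proof.
  intros hmono hloc.
  assert (hp : forall t0, {d : posreal | forall t, Rabs (t - t0) < d -> Q d t}).
  { intros t0. apply constructive_indefinite_description.
    destruct (hloc t0) as [d [hd h]]. now exists (mkposreal d hd). }
  (* The covering lemma takes the local radii as a function, hence the choice above, and yields its
     centre only under a double negation, hence the excluded middle below. *)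
  destruct (compactness_value_1d a b (fun t => proj1_sig (hp t))) as [d h].
  exists d; split; [apply cond_pos |].
  intros t ht. destruct (excluded_middle_informative (Q d t)) as [q | nq]; [exact q |].
  exfalso; apply (h t ht). intros [t0 [_ [h1 h2]]]. apply nq.
  apply (hmono _ _ _ h2). now apply (proj2_sig (hp t0)).
Qed.

(** The integrals over [[a, t]] and [[t, b]] are nonnegative with sum 0, so [RInt f a] vanishes near
    the interior point [c], and so does its derivative [f c]. *)
Lemma continuous_RInt_zero (f : R -> R) (a b c : R) :
  (forall t, continuous f t) -> (forall t, 0 <= f t) ->
  RInt f a b = 0 -> a < c < b -> f c = 0.
Proof.
  intros hc hp h0 hab.
  assert (hex : forall u v, ex_RInt f u v)
    by (intros; apply (ex_RInt_continuous (V := R_CompleteNormedModule)); intros; apply hc).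
  assert (hd : is_derive (RInt f a) c (f c)).
  { apply (is_derive_RInt f (RInt f a) a c); [| apply hc].
    apply filter_forall. intros; apply (RInt_correct (V := R_CompleteNormedModule)), hex. }
  rewrite <- (is_derive_unique _ _ _ hd).
  apply is_derive_unique, (is_derive_ext_loc (fun _ => 0)).
  - assert (hl : locally c (fun t => a < t < b)).
    { apply (locally_interval _ c a b); simpl; [tauto | tauto |]. simpl; intros; lra. }
    revert hl; apply filter_imp. intros t ht.
    assert (h1 := RInt_ge_0 f a t ltac:(lra) (hex _ _) (fun x _ => hp x)).
    assert (h2 := RInt_ge_0 f t b ltac:(lra) (hex _ _) (fun x _ => hp x)).
    assert (h3 := RInt_Chasles f a t b (hex _ _) (hex _ _)).
    rewrite h0 in h3. unfold plus in h3; simpl in h3. lra.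
  - apply (is_derive_const (K := R_AbsRing) (V := R_NormedModule)).
Qed.

(** * One-sided neighbourhoods of a circle in the polar plane *)

(** The angle varies along with the radius; such joint limits, unlike limits along a fixed ray, can
    be made uniform in the angle. *)
Definition above (r t : R) := within (fun z : R * R => r < fst z) (locally (r, t)).
Definition below (r t : R) := within (fun z : R * R => fst z < r) (locally (r, t)).

Lemma above_eps (f : R * R -> R) (r t0 l eps : R) :
  filterlim f (above r t0) (locally l) -> 0 < eps ->
  exists d, 0 < d /\ forall s t, r < s < r + d -> Rabs (t - t0) < d ->
    Rabs (f (s, t) - l) < eps.
Proof.
  intros h he.
  destruct (h _ (locally_ball l (mkposreal eps he))) as [d hd].
  exists d; split; [apply cond_pos |].
  intros s t hs ht. apply (hd (s, t)); [| simpl; lra].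
  split; simpl; [| exact ht].
  unfold ball; simpl; unfold AbsRing_ball, abs, minus, plus, opp; simpl.
  rewrite Rabs_right; lra.
Qed.

Lemma below_eps (f : R * R -> R) (r t0 l eps : R) :
  filterlim f (below r t0) (locally l) -> 0 < eps ->
  exists d, 0 < d /\ forall s t, r - d < s < r -> Rabs (t - t0) < d ->
    Rabs (f (s, t) - l) < eps.
Proof.
  intros h he.
  destruct (h _ (locally_ball l (mkposreal eps he))) as [d hd].
  exists d; split; [apply cond_pos |].
  intros s t hs ht. apply (hd (s, t)); [| simpl; lra].
  split; simpl; [| exact ht].
  unfold ball; simpl; unfold AbsRing_ball, abs, minus, plus, opp; simpl.
  rewrite Rabs_left; lra.
Qed.

(** Laplace's equation in polar coordinates [(r, t)], for [r] in [S], in the form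
    [r d/dr (r W_r) = - W_tt]. *)
Record polar_harmonic (S : R -> Prop) (W Wr Wt Wtt : R * R -> R) : Prop := {
  ph_r : forall r t : R, S r -> is_derive (fun s : R => W (s, t)) r (Wr (r, t));
  ph_t : forall r t : R, S r -> is_derive (fun s : R => W (r, s)) t (Wt (r, t));
  ph_tt : forall r t : R, S r -> is_derive (fun s : R => Wt (r, s)) t (Wtt (r, t));
  ph_rr : forall r t : R, S r ->
    is_derive (fun s : R => s * Wr (s, t)) r (- Wtt (r, t) / r);
  ph_cont : forall r t : R, S r -> continuous W (r, t);
  ph_cont_r : forall r t : R, S r -> continuous Wr (r, t);
  ph_cont_t : forall r t : R, S r -> continuous Wt (r, t);
  ph_cont_tt : forall r t : R, S r -> continuous Wtt (r, t);
  ph_per : forall r t : R, W (r, t + 2 * PI) = W (r, t);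
  ph_per_t : forall r t : R, Wt (r, t + 2 * PI) = Wt (r, t)
}.

Lemma continuous_section (f : R * R -> R) (r t : R) :
  continuous f (r, t) -> continuous (fun s => f (r, s)) t.
Proof.
  intros h.
  apply (continuous_comp_2 (fun _ : R => r) (fun s : R => s) (fun x y => f (x, y))).
  - apply continuous_const.
  - apply continuous_id.
  - revert h. apply continuous_ext. now intros [x y].
Qed.

(** * Energy and flux of a harmonic function on circles *)

Section Energy.
Variables (S : R -> Prop) (W Wr Wt Wtt : R * R -> R).
Hypothesis (hS : open S) (hpos : forall r, S r -> 0 < r).
Hypothesis hW : polar_harmonic S W Wr Wt Wtt.

(** The starting angle [a] is left free so that the window can later be centred at a given [t]: zero
    energy is shown to force [W] to vanish at interior angles of the window. *)
Definition energy (a r : R) : R :=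
  RInt (fun t => W (r, t) * W (r, t)) a (a + 2 * PI).
Definition flux (a r : R) : R :=
  RInt (fun t => W (r, t) * (r * Wr (r, t))) a (a + 2 * PI).

Let sect (f : R * R -> R) (h : forall r t, S r -> continuous f (r, t)) r t
  (hr : S r) : continuous (fun s => f (r, s)) t :=
  continuous_section f r t (h r t hr).

Lemma integrand_derive (f df : R * R -> R) (a b r : R) :
  (forall r t, S r -> is_derive (fun s => f (s, t)) r (df (r, t))) ->
  (forall r t, S r -> continuous f (r, t)) ->
  (forall r t, S r -> continuous df (r, t)) ->
  S r ->
  is_derive (fun s => RInt (fun t => f (s, t)) a b) r (RInt (fun t => df (r, t)) a b).
Proof.
  intros hd hc hdc hr.
  rewrite (RInt_ext (fun t => df (r, t)) (fun t => Derive (fun s => f (s, t)) r)).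
  2: { intros t _. symmetry. now apply is_derive_unique, hd. }
  apply (is_derive_RInt_param (fun s t => f (s, t))).
  - apply (filter_imp S); [| now apply hS].
    intros s hs t _. exists (df (s, t)). now apply hd.
  - intros t _.
    apply (continuity_2d_pt_ext_loc (fun u v => df (u, v))).
    + assert (h := hS r hr). destruct h as [d h]. exists d.
      intros u v hu _. symmetry. apply is_derive_unique, hd, h, hu.
    + apply continuity_2d_pt_filterlim.
      generalize (hdc r t hr). apply filterlim_ext. now intros [u v].
  - apply (filter_imp S); [| now apply hS].
    intros s hs. apply (ex_RInt_continuous (V := R_CompleteNormedModule)).
    intros t _. now apply sect.
Qed.

Lemma flux_integrand_continuous (r t : R) :
  S r -> continuous (fun z : R * R => W z * (fst z * Wr z)) (r, t).
Proof.
  intros hr.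
  apply (continuous_mult (K := R_AbsRing) W (fun z : R * R => fst z * Wr z)).
  - now apply (ph_cont _ _ _ _ _ hW).
  - apply (continuous_mult (K := R_AbsRing) (fun z : R * R => fst z) Wr).
    + apply continuous_fst.
    + now apply (ph_cont_r _ _ _ _ _ hW).
Qed.

Lemma energy_derive (a r : R) :
  S r -> is_derive (energy a) r (2 * flux a r / r).
Proof.
  intros hr. assert (hr0 := hpos r hr).
  replace (2 * flux a r / r)
    with (RInt (fun t => 2 * (W (r, t) * Wr (r, t))) a (a + 2 * PI)).
  - apply (integrand_derive (fun z => W z * W z) (fun z => 2 * (W z * Wr z))); [| | | exact hr].
    + intros s t hs. assert (h := ph_r _ _ _ _ _ hW s t hs).
      replace (2 * (W (s, t) * Wr (s, t)))
        with (plus (mult (Wr (s, t)) (W (s, t))) (mult (W (s, t)) (Wr (s, t))))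
        by (unfold plus, mult; simpl; ring).
      apply (is_derive_mult (fun s => W (s, t)) (fun s => W (s, t)) s); try easy.
      intros; apply Rmult_comm.
    + intros s t hs.
      apply (continuous_mult (K := R_AbsRing) W W); now apply (ph_cont _ _ _ _ _ hW).
    + intros s t hs.
      apply (continuous_scal_r (K := R_AbsRing) (V := R_NormedModule) 2 (fun z => W z * Wr z)).
      apply (continuous_mult (K := R_AbsRing) W Wr);
        [now apply (ph_cont _ _ _ _ _ hW) | now apply (ph_cont_r _ _ _ _ _ hW)].
  - unfold flux.
    replace (2 * RInt (fun t => W (r, t) * (r * Wr (r, t))) a (a + 2 * PI) / r)
      with (scal (2 / r) (RInt (fun t => W (r, t) * (r * Wr (r, t))) a (a + 2 * PI)))
      by (unfold scal; simpl; unfold mult; simpl; field; lra).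
    rewrite <- (RInt_scal (V := R_CompleteNormedModule)).
    + apply RInt_ext. intros t _. unfold scal; simpl; unfold mult; simpl. field; lra.
    + apply (ex_RInt_continuous (V := R_CompleteNormedModule)). intros t _.
      apply (continuous_section (fun z : R * R => W z * (fst z * Wr z)) r t).
      now apply flux_integrand_continuous.
Qed.

(** Green's identity on the circle: the angular part is integrated by parts, and
    periodicity cancels the end-point terms. *)
Lemma flux_derive_nonneg (a r : R) :
  S r -> exists d, is_derive (flux a) r d /\ 0 <= d.
Proof.
  intros hr. assert (hr0 := hpos r hr).
  assert (cW := ph_cont _ _ _ _ _ hW). assert (cr := ph_cont_r _ _ _ _ _ hW).
  assert (ct := ph_cont_t _ _ _ _ _ hW). assert (ctt := ph_cont_tt _ _ _ _ _ hW).
  set (df := fun z : R * R => fst z * (Wr z * Wr z) - W z * Wtt z * / fst z).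
  exists (RInt (fun t => df (r, t)) a (a + 2 * PI)). split.
  - apply (integrand_derive (fun z : R * R => W z * (fst z * Wr z)) df); [| | | exact hr].
    + intros s t hs. assert (hs0 := hpos s hs).
      replace (df (s, t)) with
        (plus (mult (Wr (s, t)) (s * Wr (s, t))) (mult (W (s, t)) (- Wtt (s, t) / s)))
        by (unfold plus, mult, df; simpl; field; lra).
      apply (is_derive_mult (fun s => W (s, t)) (fun s => s * Wr (s, t)) s).
      * now apply (ph_r _ _ _ _ _ hW).
      * now apply (ph_rr _ _ _ _ _ hW).
      * intros; apply Rmult_comm.
    + intros; now apply flux_integrand_continuous.
    + intros s t hs. assert (hs0 := hpos s hs).
      apply (continuous_minus (V := R_NormedModule)
        (fun z : R * R => fst z * (Wr z * Wr z)) (fun z : R * R => W z * Wtt z * / fst z)).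
      * apply (continuous_mult (K := R_AbsRing) (fun z : R * R => fst z) (fun z => Wr z * Wr z)).
        -- apply continuous_fst.
        -- apply (continuous_mult (K := R_AbsRing) Wr Wr); now apply cr.
      * apply (continuous_mult (K := R_AbsRing) (fun z => W z * Wtt z) (fun z => / fst z)).
        -- apply (continuous_mult (K := R_AbsRing) W Wtt); [now apply cW | now apply ctt].
        -- apply (continuous_comp (fun z : R * R => fst z) Rinv).
           ++ apply continuous_fst.
           ++ apply continuous_Rinv; simpl; lra.
  - assert (hip : is_RInt (fun t => / r * (Wt (r, t) * Wt (r, t) + W (r, t) * Wtt (r, t)))
                   a (a + 2 * PI) 0).
    { replace 0 with (minus (/ r * (W (r, a + 2 * PI) * Wt (r, a + 2 * PI)))
                            (/ r * (W (r, a) * Wt (r, a)))).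
      2: { rewrite (ph_per _ _ _ _ _ hW), (ph_per_t _ _ _ _ _ hW).
           unfold minus, plus, opp; simpl; ring. }
      apply (is_RInt_derive (V := R_CompleteNormedModule)
        (fun t => / r * (W (r, t) * Wt (r, t)))).
      - intros t _.
        apply (is_derive_scal (fun t => W (r, t) * Wt (r, t))).
        apply (is_derive_mult (fun t => W (r, t)) (fun t => Wt (r, t)) t).
        + now apply (ph_t _ _ _ _ _ hW).
        + now apply (ph_tt _ _ _ _ _ hW).
        + intros; apply Rmult_comm.
      - intros t _.
        apply (continuous_scal_r (K := R_AbsRing) (V := R_NormedModule) (/ r)
          (fun t => Wt (r, t) * Wt (r, t) + W (r, t) * Wtt (r, t))).
        apply (continuous_plus (V := R_NormedModule)
          (fun t => Wt (r, t) * Wt (r, t)) (fun t => W (r, t) * Wtt (r, t)));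
        apply (continuous_mult (K := R_AbsRing)); now apply sect. }
    assert (hdf : ex_RInt (fun t => df (r, t)) a (a + 2 * PI)).
    { apply (ex_RInt_continuous (V := R_CompleteNormedModule)). intros t _. unfold df; simpl.
      apply (continuous_minus (V := R_NormedModule)
        (fun t => r * (Wr (r, t) * Wr (r, t))) (fun t => W (r, t) * Wtt (r, t) * / r)).
      - apply (continuous_scal_r (K := R_AbsRing) (V := R_NormedModule) r
          (fun t => Wr (r, t) * Wr (r, t))).
        apply (continuous_mult (K := R_AbsRing)); now apply sect.
      - apply (continuous_mult (K := R_AbsRing) (fun t => W (r, t) * Wtt (r, t)) (fun _ => / r)).
        + apply (continuous_mult (K := R_AbsRing)); now apply sect.
        + apply continuous_const. }
    (* Adding the null integral of [(W W_t)_t / r] leaves the derivative unchanged and turns its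
       integrand into [r W_r^2 + W_t^2 / r]. *)
    assert (hs := is_RInt_plus _ _ _ _ _ _ (RInt_correct (V := R_CompleteNormedModule) _ _ _ hdf) hip).
    assert (e := is_RInt_unique (V := R_CompleteNormedModule) _ _ _ _ hs).
    unfold plus in e at 2; simpl in e. rewrite Rplus_0_r in e.
    eapply Rle_trans; [| right; exact e].
    apply RInt_ge_0.
    + generalize PI_RGT_0; lra.
    + eexists; exact hs.
    + intros t _. unfold plus, df; simpl.
      replace (_ + _) with (r * Rsqr (Wr (r, t)) + / r * Rsqr (Wt (r, t)))
        by (unfold Rsqr; field; lra).
      assert (0 < / r) by now apply Rinv_0_lt_compat.
      apply Rplus_le_le_0_compat; apply Rmult_le_pos; try apply Rle_0_sqr; lra.
Qed.

Lemma flux_nondecreasing (a x y : R) :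
  x <= y -> (forall z, x <= z <= y -> S z) -> flux a x <= flux a y.
Proof.
  intros hxy hz.
  apply (nondecreasing_of_derive _ (Derive (flux a)) x y hxy); intros z h;
    destruct (flux_derive_nonneg a z (hz z h)) as [d [hd h0]];
    rewrite (is_derive_unique _ _ _ hd); assumption.
Qed.

Lemma energy_nondecreasing (a x y : R) :
  x <= y -> (forall z, x <= z <= y -> S z /\ 0 <= flux a z) -> energy a x <= energy a y.
Proof.
  intros hxy hz.
  apply (nondecreasing_of_derive _ (fun r => 2 * flux a r / r) x y hxy); intros z h;
    destruct (hz z h) as [h1 h2].
  - now apply energy_derive.
  - apply Rmult_le_pos; [lra |]. left; apply Rinv_0_lt_compat; auto.
Qed.

Lemma flux_integrable (a b r : R) :
  S r -> ex_RInt (fun t => W (r, t) * (r * Wr (r, t))) a b.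
Proof.
  intros hr. apply (ex_RInt_continuous (V := R_CompleteNormedModule)). intros t _.
  apply (continuous_section (fun z : R * R => W z * (fst z * Wr z)) r t).
  now apply flux_integrand_continuous.
Qed.

Lemma energy_integrable (a b r : R) :
  S r -> ex_RInt (fun t => W (r, t) * W (r, t)) a b.
Proof.
  intros hr. apply (ex_RInt_continuous (V := R_CompleteNormedModule)). intros t _.
  apply (continuous_mult (K := R_AbsRing)); apply sect; try assumption;
    apply (ph_cont _ _ _ _ _ hW).
Qed.

Lemma energy_nonneg (a r : R) : S r -> 0 <= energy a r.
Proof.
  intros hr. apply RInt_ge_0; [generalize PI_RGT_0; lra | now apply energy_integrable |].
  intros t _. apply Rle_0_sqr.
Qed.

Lemma energy_zero (r t : R) : S r -> energy (t - PI) r = 0 -> W (r, t) = 0.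
Proof.
  intros hr h.
  apply Rsqr_0_uniq.
  apply (continuous_RInt_zero (fun t => W (r, t) * W (r, t)) (t - PI) (t - PI + 2 * PI)).
  - intros s. apply (continuous_mult (K := R_AbsRing)); apply sect; try assumption;
      apply (ph_cont _ _ _ _ _ hW).
  - intros s. apply Rle_0_sqr.
  - exact h.
  - generalize PI_RGT_0; lra.
Qed.

End Energy.

(** * Integrals over circles near an interface *)

Lemma filterlim_Rmult {T : Type} {F : (T -> Prop) -> Prop} {FF : Filter F}
    (f g : T -> R) (l m : R) :
  filterlim f F (locally l) -> filterlim g F (locally m) ->
  filterlim (fun x => f x * g x) F (locally (l * m)).
Proof.
  intros hf hg. apply (filterlim_comp_2 f g Rmult hf hg).
  apply (filterlim_mult (K := R_AbsRing)).
Qed.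

(** Both sides have the same limit at every angle, but [V] is not controlled on the circle [r0]
    itself. So a radius above is compared directly with one below, instead of each with [r0]. *)
Lemma RInt_gap (V : R * R -> R) (r0 a b eps : R) :
  a < b -> 0 < eps ->
  (forall t, exists l, filterlim V (above r0 t) (locally l) /\
                       filterlim V (below r0 t) (locally l)) ->
  exists d, 0 < d /\ forall r s, r0 < r < r0 + d -> r0 - d < s < r0 ->
    ex_RInt (fun t => V (r, t)) a b -> ex_RInt (fun t => V (s, t)) a b ->
    Rabs (RInt (fun t => V (r, t)) a b - RInt (fun t => V (s, t)) a b) <= eps.
Proof.
  intros hab he hl.
  set (e := eps / (b - a)).
  assert (he' : 0 < e) by (apply Rdiv_lt_0_compat; lra).
  destruct (uniform_on_segment (fun d t => forall r s, r0 < r < r0 + d ->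
    r0 - d < s < r0 -> Rabs (V (r, t) - V (s, t)) <= e) a b) as [d [hd h]].
  - intros d d' t hdd h r s hr hs. apply h; lra.
  - intros t0. destruct (hl t0) as [l [h1 h2]].
    destruct (above_eps V r0 t0 l (e / 2) h1) as [d1 [hd1 k1]]; [lra |].
    destruct (below_eps V r0 t0 l (e / 2) h2) as [d2 [hd2 k2]]; [lra |].
    assert (m1 := Rmin_l d1 d2). assert (m2 := Rmin_r d1 d2).
    exists (Rmin d1 d2). split; [now apply Rmin_glb_lt |].
    intros t ht r s hr hs.
    assert (q1 := k1 r t ltac:(lra) ltac:(lra)).
    assert (q2 := k2 s t ltac:(lra) ltac:(lra)).
    apply Rabs_def2 in q1. apply Rabs_def2 in q2. apply Rabs_le. lra.
  - exists d; split; [exact hd |]. intros r s hr hs e1 e2.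
    change (RInt (fun t => V (r, t)) a b - RInt (fun t => V (s, t)) a b)
      with (minus (RInt (fun t => V (r, t)) a b) (RInt (fun t => V (s, t)) a b)).
    rewrite <- (RInt_minus (V := R_CompleteNormedModule)) by assumption.
    replace eps with ((b - a) * e) by (unfold e; field; lra).
    apply abs_RInt_le_const; [lra | | intros t ht; now apply h].
    now apply (ex_RInt_minus (V := R_NormedModule)).
Qed.

Lemma RInt_above_small (V : R * R -> R) (r0 a b eps : R) :
  a < b -> 0 < eps ->
  (forall t, filterlim V (above r0 t) (locally 0)) ->
  exists d, 0 < d /\ forall r, r0 < r < r0 + d ->
    ex_RInt (fun t => V (r, t)) a b -> Rabs (RInt (fun t => V (r, t)) a b) <= eps.
Proof.
  intros hab he hl.
  set (e := eps / (b - a)).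
  assert (he' : 0 < e) by (apply Rdiv_lt_0_compat; lra).
  destruct (uniform_on_segment (fun d t => forall r, r0 < r < r0 + d ->
    Rabs (V (r, t)) <= e) a b) as [d [hd h]].
  - intros d d' t hdd h r hr. apply h; lra.
  - intros t0. destruct (above_eps V r0 t0 0 e (hl t0) he') as [d [hd k]].
    exists d; split; [exact hd |]. intros t ht r hr.
    assert (q := k r t hr ht). rewrite Rminus_0_r in q. lra.
  - exists d; split; [exact hd |]. intros r hr hex.
    replace eps with ((b - a) * e) by (unfold e; field; lra).
    apply abs_RInt_le_const; [lra | exact hex | intros t ht; now apply h].
Qed.

Lemma Rle_of_le_eps (x y : R) : (forall eps, 0 < eps -> x <= y + eps) -> x <= y.
Proof.
  intros h. destruct (Rle_dec x y) as [| n]; [assumption |].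
  assert (q := h ((x - y) / 2) ltac:(lra)). lra.
Qed.

Lemma filterlim_fst_within (Q : R * R -> Prop) (r t : R) :
  filterlim (fun z : R * R => fst z) (within Q (locally (r, t))) (locally r).
Proof.
  apply (filterlim_filter_le_1 _ (filter_le_within _)).
  apply (continuous_fst (U := R_UniformSpace) (V := R_UniformSpace)).
Qed.

(** * Uniqueness for the homogeneous transmission problem *)

Definition off_circles (ri re r : R) : Prop := ri < r /\ r <> re.

Lemma open_off_circles (ri re : R) : open (off_circles ri re).
Proof.
  apply open_and; [apply open_gt |].
  apply open_neq.
Qed.

Lemma transmission_unique (ri re : R) (W Wr Wt Wtt : R * R -> R) :
  0 < ri < re ->
  polar_harmonic (off_circles ri re) W Wr Wt Wtt ->
  (forall t, exists l, filterlim W (above ri t) (locally l) /\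
                       filterlim Wr (above ri t) (locally 0)) ->
  (forall t, exists l, filterlim W (above re t) (locally l) /\
                       filterlim W (below re t) (locally l)) ->
  (forall t, exists l, filterlim Wr (above re t) (locally l) /\
                       filterlim Wr (below re t) (locally l)) ->
  (exists M R0, forall r t, R0 <= r -> Rabs (W (r, t)) <= M / r) ->
  forall r t, off_circles ri re r -> W (r, t) = 0.
Proof.
  intros hri hW hN hT hTr [M [R0 hM]] r t hr.
  assert (hS := open_off_circles ri re).
  assert (hpos : forall r, off_circles ri re r -> 0 < r) by (intros s [h _]; lra).
  apply (energy_zero _ _ _ _ _ hW _ _ hr).
  set (a := t - PI).
  assert (hPI := PI_RGT_0).
  assert (hab : a < a + 2 * PI) by lra.
  assert (hE : forall s, off_circles ri re s -> 0 <= energy W a s)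
    by (intros; eapply energy_nonneg; eassumption).
  assert (iE := fun s => energy_integrable _ _ _ _ _ hW a (a + 2 * PI) s).
  assert (iF := fun s => flux_integrable _ _ _ _ _ hW a (a + 2 * PI) s).
  assert (mE := energy_nondecreasing _ _ _ _ _ hS hpos hW a).
  assert (mF := flux_nondecreasing _ _ _ _ _ hS hpos hW a).
  assert (gapE : forall eps, 0 < eps -> exists d, 0 < d /\ forall r s,
    re < r < re + d -> Rmax ri (re - d) < s < re ->
    Rabs (energy W a r - energy W a s) <= eps).
  { intros eps he.
    destruct (RInt_gap (fun z => W z * W z) re a (a + 2 * PI) eps hab he) as [d [hd h]].
    - intros t0. destruct (hT t0) as [l [h1 h2]]. exists (l * l).
      split; now apply filterlim_Rmult.
    - exists d; split; [exact hd |]. intros x y hx hy.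
      assert (m1 := Rmax_l ri (re - d)). assert (m2 := Rmax_r ri (re - d)).
      apply (h x y hx); [lra | apply iE; split; lra | apply iE; split; lra]. }
  assert (gapF : forall eps, 0 < eps -> exists d, 0 < d /\ forall r s,
    re < r < re + d -> Rmax ri (re - d) < s < re ->
    Rabs (flux W Wr a r - flux W Wr a s) <= eps).
  { intros eps he.
    destruct (RInt_gap (fun z => W z * (fst z * Wr z)) re a (a + 2 * PI) eps hab he)
      as [d [hd h]].
    - intros t0. destruct (hT t0) as [l [h1 h2]]. destruct (hTr t0) as [m [k1 k2]].
      exists (l * (re * m)).
      split; apply filterlim_Rmult; try assumption; apply filterlim_Rmult; try assumption;
        apply filterlim_fst_within.
    - exists d; split; [exact hd |]. intros x y hx hy.
      assert (m1 := Rmax_l ri (re - d)). assert (m2 := Rmax_r ri (re - d)).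
      apply (h x y hx); [lra | apply iF; split; lra | apply iF; split; lra]. }
  (* Near [ri], [W] has a finite limit and [W_r] tends to 0, so the flux exceeds [- eps] at some
     radius [x] before [s]; monotonicity carries this bound to [s]. *)
  assert (F1 : forall s, ri < s < re -> 0 <= flux W Wr a s).
  { intros s hs. apply Rle_of_le_eps. intros eps he.
    destruct (RInt_above_small (fun z => W z * (fst z * Wr z)) ri a (a + 2 * PI) eps hab he)
      as [d [hd h]].
    - intros t0. destruct (hN t0) as [l [h1 h2]].
      replace 0 with (l * (ri * 0)) by ring.
      apply filterlim_Rmult; [assumption |]. apply filterlim_Rmult; [| assumption].
      apply filterlim_fst_within.
    - set (x := ri + Rmin d (s - ri) / 2).
      assert (m0 : 0 < Rmin d (s - ri)) by (apply Rmin_glb_lt; lra).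
      assert (m1 := Rmin_l d (s - ri)). assert (m2 := Rmin_r d (s - ri)).
      assert (hx : ri < x < ri + d) by (unfold x; lra).
      assert (hx' : x <= s) by (unfold x; lra).
      assert (q := h x hx (iF x ltac:(split; lra))). simpl in q.
      fold (flux W Wr a x) in q. apply Rabs_le_between in q.
      assert (flux W Wr a x <= flux W Wr a s)
        by (apply mF; [lra | intros z hz; split; lra]).
      lra. }
  (* The flux is monotone on each side of [re] separately; the gap estimate between [y] just inside
     and [x] just outside joins the two ranges. *)
  assert (F2 : forall s, re < s -> 0 <= flux W Wr a s).
  { intros s hs. apply Rle_of_le_eps. intros eps he.
    destruct (gapF eps he) as [d [hd h]].
    assert (m0 : 0 < Rmin d (s - re)) by (apply Rmin_glb_lt; lra).
    assert (m1 := Rmin_l d (s - re)). assert (m2 := Rmin_r d (s - re)).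
    set (x := re + Rmin d (s - re) / 2).
    assert (m3 : Rmax ri (re - d) < re) by (apply Rmax_lub_lt; lra).
    assert (m4 := Rmax_l ri (re - d)).
    set (y := (Rmax ri (re - d) + re) / 2).
    assert (q := h x y ltac:(unfold x; lra) ltac:(unfold y; lra)).
    apply Rabs_le_between in q.
    assert (0 <= flux W Wr a y) by (apply F1; unfold y; lra).
    assert (flux W Wr a x <= flux W Wr a s)
      by (apply mF; [unfold x; lra | unfold x; intros z hz; split; lra]).
    lra. }
  assert (E2 : forall s, re < s -> energy W a s <= 0).
  { intros s hs. apply Rle_of_le_eps. intros eps he.
    set (K := 2 * PI * (M * M)).
    assert (hK : 0 <= K) by (apply Rmult_le_pos; [lra | apply Rle_0_sqr]).
    (* Decay gives energy at most [K / x^2], hence at most [K / x] because [x >= 1]; the term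
       [K / eps] brings this below [eps]. *)
    set (x := Rmax (Rmax s R0) (1 + K / eps)).
    assert (x1 : s <= x) by (eapply Rle_trans; [apply Rmax_l | apply Rmax_l]).
    assert (x2 : R0 <= x) by (eapply Rle_trans; [apply Rmax_r | apply Rmax_l]).
    assert (x3 : 1 + K / eps <= x) by apply Rmax_r.
    assert (hKe : 0 <= K / eps) by (apply Rdiv_le_0_compat; lra).
    assert (energy W a s <= energy W a x).
    { apply mE; [lra |]. intros z hz; split; [split; lra | apply F2; lra]. }
    assert (energy W a x <= K / x).
    { eapply Rle_trans; [apply Rle_abs |].
      replace (K / x) with ((a + 2 * PI - a) * ((M * M) / x)) by (unfold K; field; lra).
      apply abs_RInt_le_const; [lra | apply iE; split; lra |].
      intros u _. rewrite Rabs_mult.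
      assert (hu := hM x u x2). assert (h0 := Rabs_pos (W (x, u))).
      apply Rle_trans with (M / x * (M / x)); [now apply Rmult_le_compat |].
      replace (M / x * (M / x)) with (M * M / x * / x) by (field; lra).
      rewrite <- (Rmult_1_r (M * M / x)) at 2.
      apply Rmult_le_compat_l.
      - apply Rmult_le_pos; [apply Rle_0_sqr | left; apply Rinv_0_lt_compat; lra].
      - rewrite <- Rinv_1. apply Rinv_le_contravar; lra. }
    assert (K / x <= eps).
    { apply Rle_div_l; [lra |].
      apply Rle_trans with (eps * (K / eps)); [right; field; lra |].
      apply Rmult_le_compat_l; lra. }
    lra. }
  apply Rle_antisym; [| now apply hE].
  destruct hr as [hr1 hr2].
  destruct (Rlt_dec re r) as [h | h]; [now apply E2 |].
  (* Inside [re], the energy at [r] is at most that at [y] just below [re], which is within [eps] of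
     an energy just above [re], already known to be nonpositive. *)
  apply Rle_of_le_eps. intros eps he.
  destruct (gapE eps he) as [d [hd hg]].
  assert (m3 : Rmax r (re - d) < re) by (apply Rmax_lub_lt; lra).
  assert (m4 := Rmax_l r (re - d)). assert (m5 := Rmax_r r (re - d)).
  set (y := (Rmax r (re - d) + re) / 2).
  assert (q := hg (re + d / 2) y ltac:(lra)
    ltac:(split; [apply Rmax_lub_lt; unfold y; lra | unfold y; lra])).
  apply Rabs_le_between in q.
  assert (energy W a (re + d / 2) <= 0) by (apply E2; lra).
  assert (energy W a r <= energy W a y).
  { apply mE; [unfold y; lra |]. unfold y; intros z hz; split; [split; lra | apply F1; lra]. }
  lra.
Qed.

(** * Differences, localization and restriction of polar harmonic functions *)

Lemma polar_harmonic_minus (S : R -> Prop) (W Wr Wt Wtt V Vr Vt Vtt : R * R -> R) :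
  polar_harmonic S W Wr Wt Wtt -> polar_harmonic S V Vr Vt Vtt ->
  (forall r, S r -> r <> 0) ->
  polar_harmonic S (fun z => W z - V z) (fun z => Wr z - Vr z)
    (fun z => Wt z - Vt z) (fun z => Wtt z - Vtt z).
Proof.
  intros [] [] h0.
  split; intros r t; try (intros hr);
    try (apply (continuous_minus (V := R_NormedModule)); auto);
    try (apply (is_derive_minus (V := R_NormedModule)); auto).
  - replace (- (Wtt (r, t) - Vtt (r, t)) / r)
      with (minus (- Wtt (r, t) / r) (- Vtt (r, t) / r))
      by (unfold minus, plus, opp; simpl; field; now apply h0).
    apply (is_derive_ext (fun s => minus (s * Wr (s, t)) (s * Vr (s, t)))).
    + intros s. unfold minus, plus, opp; simpl; ring.
    + apply (is_derive_minus (V := R_NormedModule)); auto.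
  - f_equal; auto.
  - f_equal; auto.
Qed.

Lemma locally_fst (Q : R -> Prop) (r t : R) :
  locally r Q -> locally (r, t) (fun z : R * R => Q (fst z)).
Proof. exact (continuous_fst (U := R_UniformSpace) (V := R_UniformSpace) r t Q). Qed.

(** Being [polar_harmonic] on [{r}] only involves derivatives at [r], so the
    condition can be checked locally. *)
Lemma polar_harmonic_local (S : R -> Prop) (W Wr Wt Wtt : R * R -> R) :
  (forall r : R, S r -> exists V Vr Vt Vtt, polar_harmonic (eq r) V Vr Vt Vtt /\
     locally r (fun s : R => forall t : R, V (s, t) = W (s, t) /\ Vr (s, t) = Wr (s, t) /\
                           Vt (s, t) = Wt (s, t) /\ Vtt (s, t) = Wtt (s, t))) ->
  (forall r t, W (r, t + 2 * PI) = W (r, t)) ->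
  (forall r t, Wt (r, t + 2 * PI) = Wt (r, t)) ->
  polar_harmonic S W Wr Wt Wtt.
Proof.
  intros hloc hper hpert.
  split; try assumption; intros r t hr; simpl;
    destruct (hloc r hr) as [V [Vr [Vt [Vtt [[] h]]]]];
    assert (e := locally_singleton _ _ h t); simpl in e; destruct e as [e1 [e2 [e3 e4]]].
  - rewrite <- e2. apply (is_derive_ext_loc (fun s => V (s, t))); [| auto].
    revert h; apply filter_imp; intros s hs; apply hs.
  - rewrite <- e3. apply (is_derive_ext (fun s => V (r, s))); [| auto].
    intros s. apply (locally_singleton _ _ h).
  - rewrite <- e4. apply (is_derive_ext (fun s => Vt (r, s))); [| auto].
    intros s. apply (locally_singleton _ _ h).
  - rewrite <- e4. apply (is_derive_ext_loc (fun s => s * Vr (s, t))); [| auto].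
    revert h; apply filter_imp; intros s hs. f_equal; apply hs.
  - apply (continuous_ext_loc _ V); [| auto].
    generalize (locally_fst _ r t h); apply filter_imp. intros [x y] hx; apply hx.
  - apply (continuous_ext_loc _ Vr); [| auto].
    generalize (locally_fst _ r t h); apply filter_imp. intros [x y] hx; apply hx.
  - apply (continuous_ext_loc _ Vt); [| auto].
    generalize (locally_fst _ r t h); apply filter_imp. intros [x y] hx; apply hx.
  - apply (continuous_ext_loc _ Vtt); [| auto].
    generalize (locally_fst _ r t h); apply filter_imp. intros [x y] hx; apply hx.
Qed.

Lemma polar_harmonic_sub (S S' : R -> Prop) (W Wr Wt Wtt : R * R -> R) :
  (forall r, S' r -> S r) ->
  polar_harmonic S W Wr Wt Wtt -> polar_harmonic S' W Wr Wt Wtt.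
Proof. intros h []; split; auto. Qed.

Lemma continuous_separated (f g : R -> R) (r t : R) :
  continuous f r -> continuous g t ->
  continuous (fun z : R * R => f (fst z) * g (snd z)) (r, t).
Proof.
  intros hf hg.
  apply (continuous_mult (K := R_AbsRing) (fun z : R * R => f (fst z))
    (fun z : R * R => g (snd z))).
  - apply (continuous_comp (fun z : R * R => fst z) f); [apply continuous_fst | exact hf].
  - apply (continuous_comp (fun z : R * R => snd z) g); [apply continuous_snd | exact hg].
Qed.

(** * Separated solutions of Laplace's equation *)

Section Modes.
Variables (n : nat) (d : R).

(** The operator [r d/dr] sends [radial A B] to [INR n * radial A (- B)]. This is the source of
    [- B] in [mode_r], and applying it twice gives the factor [n^2] that balances the angular
    derivative. *)
Definition radial (A B r : R) : R := A * r ^ n + B / r ^ n.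
Definition mode (A B : R) (z : R * R) : R :=
  radial A B (fst z) * cos (INR n * snd z - d).
Definition mode_r (A B : R) (z : R * R) : R :=
  INR n * radial A (- B) (fst z) / fst z * cos (INR n * snd z - d).
Definition mode_t (A B : R) (z : R * R) : R :=
  radial A B (fst z) * (- INR n * sin (INR n * snd z - d)).
Definition mode_tt (A B : R) (z : R * R) : R :=
  radial A B (fst z) * (- INR n * INR n * cos (INR n * snd z - d)).

Lemma radial_derive (A B r : R) :
  r <> 0 -> is_derive (radial A B) r (INR n * radial A (- B) r / r).
Proof.
  intros hr. unfold radial.
  assert (hn : forall k, r ^ k <> 0) by (intros; now apply pow_nonzero).
  auto_derive; [apply hn |].
  destruct n as [| k]; [simpl; field; exact hr |].
  change (Nat.pred (S k)) with k.
  replace (r ^ S k) with (r * r ^ k) by reflexivity.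
  field. split; [apply hn | exact hr].
Qed.

Lemma angle_shift_period (t : R) :
  INR n * (t + 2 * PI) - d = INR n * t - d + 2 * INR n * PI.
Proof. ring. Qed.

Lemma mode_harmonic (A B r : R) :
  r <> 0 -> polar_harmonic (eq r) (mode A B) (mode_r A B) (mode_t A B) (mode_tt A B).
Proof.
  intros hr.
  assert (cr : forall A B, continuous (radial A B) r).
  { intros A' B'. apply (ex_derive_continuous (V := R_NormedModule)).
    eexists. now apply radial_derive. }
  split; try (intros r' t <-); unfold mode, mode_r, mode_t, mode_tt; simpl.
  - apply (is_derive_ext (fun s => scal (radial A B s) (cos (INR n * t - d)))); [reflexivity |].
    apply (is_derive_scal_l (K := R_AbsRing) (V := R_NormedModule)).
    now apply radial_derive.
  - auto_derive; [exact I | unfold Rminus; ring].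
  - auto_derive; [exact I | unfold Rminus; ring].
  - assert (h := is_derive_scal_l (K := R_AbsRing) (V := R_NormedModule) _ _ _
      (INR n * cos (INR n * t - d)) (radial_derive A (- B) r hr)).
    assert (hl : locally r (fun s => s <> 0)) by (apply (open_neq 0); exact hr).
    replace (- (radial A B r * (- INR n * INR n * cos (INR n * t - d))) / r)
      with (scal (INR n * radial A (- - B) r / r) (INR n * cos (INR n * t - d))).
    + revert h. apply is_derive_ext_loc. revert hl; apply filter_imp.
      intros s hs. unfold scal; simpl; unfold mult; simpl. field; exact hs.
    + rewrite Ropp_involutive. unfold scal; simpl; unfold mult; simpl. field; exact hr.
  - apply (continuous_separated (radial A B) (fun t => cos (INR n * t - d))); [apply cr |].
    apply (ex_derive_continuous (V := R_NormedModule)); auto_derive; exact I.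
  - apply (continuous_separated (fun r => INR n * radial A (- B) r / r)
      (fun t => cos (INR n * t - d))).
    + apply (continuous_mult (K := R_AbsRing) (fun r => INR n * radial A (- B) r) Rinv).
      * apply (continuous_scal_r (K := R_AbsRing) (V := R_NormedModule)), cr.
      * now apply continuous_Rinv.
    + apply (ex_derive_continuous (V := R_NormedModule)); auto_derive; exact I.
  - apply (continuous_separated (radial A B) (fun t => - INR n * sin (INR n * t - d)));
      [apply cr |].
    apply (ex_derive_continuous (V := R_NormedModule)); auto_derive; exact I.
  - apply (continuous_separated (radial A B) (fun t => - INR n * INR n * cos (INR n * t - d)));
      [apply cr |].
    apply (ex_derive_continuous (V := R_NormedModule)); auto_derive; exact I.
  - intros s t. now rewrite angle_shift_period, cos_period.
  - intros s t. now rewrite angle_shift_period, sin_period.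
Qed.

(** For [n >= 1] the decaying part of a mode respects the rate [O(1/r)] demanded at infinity. *)
Lemma radial_bound (B r : R) : (1 <= n)%nat -> 1 <= r -> Rabs (radial 0 B r) <= Rabs B / r.
Proof.
  intros hn hr. unfold radial. rewrite Rmult_0_l, Rplus_0_l.
  assert (h : r <= r ^ n) by (rewrite <- (pow_1 r) at 1; now apply Rle_pow).
  unfold Rdiv. rewrite Rabs_mult. apply Rmult_le_compat_l; [apply Rabs_pos |].
  rewrite Rabs_right.
  - apply Rinv_le_contravar; lra.
  - left; apply Rinv_0_lt_compat; lra.
Qed.

End Modes.

(** * Real and imaginary parts, and the chain rule *)

(** The energy argument is for real functions; the boolean lets one proof serve both components of a
    complex potential. *)
Definition part (b : bool) (z : C) : R := if b then fst z else snd z.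

Lemma part_continuous (b : bool) (z : C) : filterlim (part b) (locally z) (locally (part b z)).
Proof.
  destruct b.
  - destruct z; apply (continuous_fst (U := R_UniformSpace) (V := R_UniformSpace)).
  - destruct z; apply (continuous_snd (U := R_UniformSpace) (V := R_UniformSpace)).
Qed.

Lemma part_le_Cmod (b : bool) (z : C) : Rabs (part b z) <= Cmod z.
Proof.
  eapply Rle_trans; [| apply Rmax_Cmod]. destruct b; [apply Rmax_l | apply Rmax_r].
Qed.

Lemma part_ext (y z : C) : (forall b, part b y = part b z) -> y = z.
Proof.
  intros h. assert (h1 := h true). assert (h2 := h false).
  destruct y, z; simpl in *. now subst.
Qed.

Lemma ex_derive_part (b : bool) (f : R -> C) (x : R) :
  ex_derive (V := C_R_NormedModule) f x -> ex_derive (fun s => part b (f s)) x.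
Proof.
  intros [l h].
  assert (hp : is_linear (K := R_AbsRing) (U := C_R_NormedModule) (V := R_NormedModule) (part b)).
  { destruct b.
    - apply (is_linear_fst (K := R_AbsRing) (U := R_NormedModule) (V := R_NormedModule)).
    - apply (is_linear_snd (K := R_AbsRing) (U := R_NormedModule) (V := R_NormedModule)). }
  apply ex_derive_filterdiff. eexists.
  apply (filterdiff_comp' (K := R_AbsRing) (U := R_NormedModule) (V := C_R_NormedModule)
    (W := R_NormedModule) f (part b) x); [exact h |].
  now apply filterdiff_linear.
Qed.

(** Mere partial derivatives give no chain rule along rays and circles; continuity of [d1 u]
    upgrades them to total differentiability. *)
Lemma C1_filterdiff (U : R * R -> Prop) (u : R * R -> C) (b : bool) (x y : R) :
  open U -> C1_on U u -> U (x, y) ->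
  filterdiff (fun z : R * R => part b (u (fst z, snd z))) (locally (x, y))
    (fun h : R * R => fst h * part b (d1 u (x, y)) + snd h * part b (d2 u (x, y))).
Proof.
  intros hU hu hs.
  assert (e1 : forall x, part b (d1 u x) = Derive (fun s => part b (u (s, snd x))) (fst x))
    by (now destruct b).
  assert (e2 : forall x, part b (d2 u x) = Derive (fun s => part b (u (fst x, s))) (snd x))
    by (now destruct b).
  apply (is_derive_filterdiff (fun x y => part b (u (x, y))) x y
    (fun x y => part b (d1 u (x, y)))).
  - generalize (hU _ hs). apply filter_imp. intros [x' y'] hx. simpl.
    rewrite e1. apply Derive_correct. apply ex_derive_part. apply (hu _ hx).
  - rewrite e2. apply Derive_correct. apply ex_derive_part. apply (hu _ hs).
  - apply (continuous_ext (fun z => part b (d1 u z))); [now intros [x' y'] |].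
    apply (continuous_comp (d1 u) (part b)).
    + apply (hu _ hs).
    + apply part_continuous.
Qed.

Lemma C1_chain (U : R * R -> Prop) (u : R * R -> C) (b : bool) (c1 c2 : R -> R) (s l1 l2 : R) :
  open U -> C1_on U u -> U (c1 s, c2 s) -> is_derive c1 s l1 -> is_derive c2 s l2 ->
  is_derive (fun s => part b (u (c1 s, c2 s))) s
    (part b (d1 u (c1 s, c2 s)) * l1 + part b (d2 u (c1 s, c2 s)) * l2).
Proof.
  intros hU hu hs h1 h2. apply is_derive_Reals.
  apply (derivable_pt_lim_comp_2d (fun x y => part b (u (x, y)))); try now apply is_derive_Reals.
  apply filterdiff_differentiable_pt_lim. now apply (C1_filterdiff U).
Qed.

Lemma C1_continuous (U : R * R -> Prop) (u : R * R -> C) (b : bool) (x : R * R) :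
  open U -> C1_on U u -> U x -> continuous (fun y => part b (u y)) x.
Proof.
  intros hU hu hx. destruct x as [x y].
  apply (continuous_ext (fun z : R * R => part b (u (fst z, snd z)))); [now intros [] |].
  apply (filterdiff_continuous (K := R_AbsRing)
    (U := prod_NormedModule _ R_NormedModule R_NormedModule) (V := R_NormedModule)).
  eexists. now apply (C1_filterdiff U).
Qed.

(** * Harmonic functions in polar coordinates *)

Definition trace (b : bool) (u : R * R -> C) (z : R * R) : R :=
  part b (u (polar (fst z) (snd z))).
(** The polar derivatives are spelled out by the chain rule rather than through [Derive], so that
    continuity and boundary limits are inherited from the Cartesian derivatives. [trace_r] is the
    normal derivative on circles. *)
Definition trace_r (b : bool) (u : R * R -> C) (z : R * R) : R :=
  trace b (d1 u) z * cos (snd z) + trace b (d2 u) z * sin (snd z).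
Definition trace_t (b : bool) (u : R * R -> C) (z : R * R) : R :=
  trace b (d1 u) z * (- fst z * sin (snd z)) + trace b (d2 u) z * (fst z * cos (snd z)).
Definition trace_tt (b : bool) (u : R * R -> C) (z : R * R) : R :=
  trace_t b (d1 u) z * (- fst z * sin (snd z)) + trace b (d1 u) z * (- fst z * cos (snd z)) +
  (trace_t b (d2 u) z * (fst z * cos (snd z)) + trace b (d2 u) z * (fst z * - sin (snd z))).

Lemma continuous_Rplus (f g : R * R -> R) (z : R * R) :
  continuous f z -> continuous g z -> continuous (fun z => f z + g z) z.
Proof. apply (continuous_plus (V := R_NormedModule)). Qed.

Lemma continuous_Rmult (f g : R * R -> R) (z : R * R) :
  continuous f z -> continuous g z -> continuous (fun z => f z * g z) z.
Proof. apply (continuous_mult (K := R_AbsRing)). Qed.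

Lemma continuous_smooth_separated (f g : R -> R) (r t : R) :
  ex_derive f r -> ex_derive g t ->
  continuous (fun z : R * R => f (fst z) * g (snd z)) (r, t).
Proof.
  intros hf hg.
  apply continuous_separated; now apply (ex_derive_continuous (V := R_NormedModule)).
Qed.

Lemma continuous_polar (r t : R) :
  continuous (fun z : R * R => polar (fst z) (snd z)) (r, t).
Proof.
  apply (continuous_comp_2 (fun z : R * R => fst z * cos (snd z))
    (fun z : R * R => fst z * sin (snd z)) (fun x y => (x, y))).
  - apply (continuous_smooth_separated (fun r => r) cos); auto_derive; exact I.
  - apply (continuous_smooth_separated (fun r => r) sin); auto_derive; exact I.
  - apply (continuous_ext (fun z => z)); [now intros [] | apply continuous_id].
Qed.

Lemma polar_period (r t : R) : polar r (t + 2 * PI) = polar r t.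
Proof.
  unfold polar. generalize (cos_period t 1), (sin_period t 1). simpl INR.
  replace (t + 2 * 1 * PI) with (t + 2 * PI) by ring. now intros -> ->.
Qed.

Section Trace.
Variables (U : R * R -> Prop) (hU : open U) (b : bool).

Lemma trace_derive_r (v : R * R -> C) (r t : R) :
  C1_on U v -> U (polar r t) -> is_derive (fun s : R => trace b v (s, t)) r (trace_r b v (r, t)).
Proof.
  intros hv hp.
  apply (C1_chain U v b (fun s => s * cos t) (fun s => s * sin t)); try assumption.
  - auto_derive; [exact I | simpl; ring].
  - auto_derive; [exact I | simpl; ring].
Qed.

Lemma trace_derive_t (v : R * R -> C) (r t : R) :
  C1_on U v -> U (polar r t) -> is_derive (fun s : R => trace b v (r, s)) t (trace_t b v (r, t)).
Proof.
  intros hv hp.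
  apply (C1_chain U v b (fun s => r * cos s) (fun s => r * sin s)); try assumption.
  - auto_derive; [exact I | simpl; ring].
  - auto_derive; [exact I | simpl; ring].
Qed.

Lemma trace_continuous (v : R * R -> C) (r t : R) :
  continuous (fun y => part b (v y)) (polar r t) -> continuous (trace b v) (r, t).
Proof.
  intros h.
  apply (continuous_comp (fun z : R * R => polar (fst z) (snd z)) (fun y => part b (v y))).
  - apply continuous_polar.
  - exact h.
Qed.

(** This is [r (r u_r)_r + u_tt = r^2 (u_11 + u_22)]. The two mixed derivatives enter both terms on
    the left through the same sum, with opposite signs, and cancel without being interchanged. *)
Lemma harmonic_polar (S : R -> Prop) (u : R * R -> C) :
  (forall r t, S r -> U (polar r t)) -> (forall r, S r -> r <> 0) ->
  harmonic_on U u ->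
  polar_harmonic S (trace b u) (trace_r b u) (trace_t b u) (trace_tt b u).
Proof.
  intros hSU hS0 [[hu [hu1 hu2]] hlap].
  assert (cc : forall v, C1_on U v -> forall r t, S r -> continuous (trace b v) (r, t)).
  { intros v hv r t hr. apply trace_continuous, (C1_continuous U); auto. }
  assert (c1 : forall v, C1_on U v -> forall r t, S r -> continuous (trace b (d1 v)) (r, t)).
  { intros v hv r t hr. apply trace_continuous, (continuous_comp (d1 v) (part b)).
    - apply (hv (polar r t)); auto.
    - apply part_continuous. }
  assert (c2 : forall v, C1_on U v -> forall r t, S r -> continuous (trace b (d2 v)) (r, t)).
  { intros v hv r t hr. apply trace_continuous, (continuous_comp (d2 v) (part b)).
    - apply (hv (polar r t)); auto.
    - apply part_continuous. }
  assert (ct : forall v, C1_on U v -> forall r t, S r -> continuous (trace_t b v) (r, t)).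
  { intros v hv r t hr. unfold trace_t.
    apply continuous_Rplus; apply continuous_Rmult; auto;
      [apply (continuous_smooth_separated (fun r => - r) sin)
      | apply (continuous_smooth_separated (fun r => r) cos)];
      auto_derive; exact I. }
  split.
  - intros r t hr. apply trace_derive_r; auto.
  - intros r t hr. apply trace_derive_t; auto.
  - intros r t hr.
    assert (k1 := trace_derive_t (d1 u) r t hu1 (hSU r t hr)).
    assert (k2 := trace_derive_t (d2 u) r t hu2 (hSU r t hr)).
    apply (is_derive_plus (V := R_NormedModule)
      (fun s : R => trace b (d1 u) (r, s) * (- r * sin s))
      (fun s : R => trace b (d2 u) (r, s) * (r * cos s))).
    + apply (is_derive_mult (fun s : R => trace b (d1 u) (r, s)) (fun s : R => - r * sin s) t).
      * exact k1.
      * auto_derive; [exact I | simpl; ring].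
      * intros; apply Rmult_comm.
    + apply (is_derive_mult (fun s : R => trace b (d2 u) (r, s)) (fun s : R => r * cos s) t).
      * exact k2.
      * auto_derive; [exact I | simpl; ring].
      * intros; apply Rmult_comm.
  - intros r t hr.
    assert (k1 := trace_derive_r (d1 u) r t hu1 (hSU r t hr)).
    assert (k2 := trace_derive_r (d2 u) r t hu2 (hSU r t hr)).
    assert (hl : trace b (d2 (d2 u)) (r, t) = - trace b (d1 (d1 u)) (r, t)).
    { assert (e := f_equal (part b) (hlap (polar r t) (hSU r t hr))).
      unfold trace; simpl. unfold laplacian in e.
      destruct b; simpl in *; lra. }
    replace (- trace_tt b u (r, t) / r)
      with (plus (mult 1 (trace_r b u (r, t)))
             (mult r (plus (mult (trace_r b (d1 u) (r, t)) (cos t))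
                           (mult (trace_r b (d2 u) (r, t)) (sin t))))).
    + apply (is_derive_mult (fun s : R => s) (fun s : R => trace_r b u (s, t)) r).
      * apply (is_derive_id (K := R_AbsRing)).
      * apply (is_derive_plus (V := R_NormedModule)
          (fun s : R => trace b (d1 u) (s, t) * cos t)
          (fun s : R => trace b (d2 u) (s, t) * sin t)).
        -- now apply (is_derive_scal_l (K := R_AbsRing) (V := R_NormedModule)
             (fun s : R => trace b (d1 u) (s, t))).
        -- now apply (is_derive_scal_l (K := R_AbsRing) (V := R_NormedModule)
             (fun s : R => trace b (d2 u) (s, t))).
      * intros; apply Rmult_comm.
    + unfold plus, mult; simpl.
      unfold trace_tt, trace_t, trace_r. simpl. rewrite hl.
      assert (hcs := sin2_cos2 t). unfold Rsqr in hcs.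
      assert (e : cos t * cos t = 1 - sin t * sin t) by lra.
      apply Rmult_eq_reg_r with r; [| now apply hS0].
      field_simplify_eq; [| now apply hS0]. ring [e].
  - auto.
  - intros r t hr. unfold trace_r.
    apply continuous_Rplus; apply continuous_Rmult; auto.
    + apply (continuous_comp (fun z : R * R => snd z) cos); [apply continuous_snd | apply continuous_cos].
    + apply (continuous_comp (fun z : R * R => snd z) sin); [apply continuous_snd | apply continuous_sin].
  - auto.
  - intros r t hr. unfold trace_tt.
    repeat apply continuous_Rplus; apply continuous_Rmult; auto;
      [ apply (continuous_smooth_separated (fun r => - r) sin)
      | apply (continuous_smooth_separated (fun r => - r) cos)
      | apply (continuous_smooth_separated (fun r => r) cos)
      | apply (continuous_smooth_separated (fun r => r) (fun t => - sin t)) ];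
      auto_derive; exact I.
  - intros r t. unfold trace; simpl. now rewrite polar_period.
  - intros r t. unfold trace_t, trace; simpl. rewrite polar_period.
    generalize (cos_period t 1), (sin_period t 1). simpl INR.
    replace (t + 2 * 1 * PI) with (t + 2 * PI) by ring. now intros -> ->.
Qed.

End Trace.

(** * Disks: polar coordinates, closures, boundaries and normals *)

Lemma enorm_polar (r t : R) : 0 <= r -> enorm (polar r t) = r.
Proof.
  intros hr. unfold enorm, dot, polar; simpl.
  replace (r * cos t * (r * cos t) + r * sin t * (r * sin t)) with (Rsqr r).
  - now apply sqrt_Rsqr.
  - assert (h := sin2_cos2 t). unfold Rsqr in *.
    transitivity (r * r * (sin t * sin t + cos t * cos t)); [rewrite h |]; ring.
Qed.

Lemma enorm_sqr (x : R * R) : enorm x * enorm x = fst x * fst x + snd x * snd x.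
Proof.
  unfold enorm, dot. apply sqrt_sqrt.
  apply Rplus_le_le_0_compat; apply Rle_0_sqr.
Qed.

Lemma enorm_nonneg (x : R * R) : 0 <= enorm x.
Proof. apply sqrt_pos. Qed.

Lemma continuous_enorm (x : R * R) : continuous enorm x.
Proof.
  apply (continuous_comp (fun x => dot x x) sqrt); [| apply continuous_sqrt].
  apply continuous_Rplus; apply continuous_Rmult;
    destruct x; (apply continuous_fst || apply continuous_snd).
Qed.

Lemma polar_surjective (x : R * R) :
  0 < enorm x -> exists t, 0 <= t < 2 * PI /\ polar (enorm x) t = x.
Proof.
  intros hr. destruct x as [x y]. set (r := enorm (x, y)) in *.
  assert (hsq := enorm_sqr (x, y)). fold r in hsq; simpl in hsq.
  assert (hPI := PI_RGT_0).
  assert (hb : -1 <= x / r <= 1).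
  { assert (0 <= y * y) by apply Rle_0_sqr.
    split.
    - apply Rle_div_r; [lra |]. nra.
    - apply Rle_div_l; [lra |]. nra. }
  assert (hc := cos_acos _ hb). assert (ha := acos_bound (x / r)).
  assert (hs : sin (acos (x / r)) = Rabs y / r).
  { rewrite sin_acos by assumption.
    replace (1 - (x / r)²) with (Rsqr (Rabs y / r)).
    - apply sqrt_Rsqr. apply Rmult_le_pos; [apply Rabs_pos |].
      left; now apply Rinv_0_lt_compat.
    - rewrite !Rsqr_div', <- Rsqr_abs. unfold Rsqr.
      apply Rmult_eq_reg_r with (r * r); [| nra]. field_simplify; [lra | lra | lra]. }
  destruct (Rle_dec 0 y) as [hy | hy].
  - exists (acos (x / r)). split; [lra |].
    unfold polar. rewrite hc, hs, Rabs_right by lra. f_equal; field; lra.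
  - exists (2 * PI - acos (x / r)). split.
    + split; [lra |].
      (* The angle must stay strictly below [2 PI]: a zero arccosine would give [sin = 0],
         contradicting [y < 0]. *)
      destruct (Req_dec (acos (x / r)) 0) as [e | e]; [| lra].
      rewrite e, sin_0 in hs. exfalso.
      assert (h0 : 0 < Rabs y / r) by (apply Rdiv_lt_0_compat; [apply Rabs_pos_lt; lra | lra]).
      lra.
    + unfold polar.
      replace (2 * PI - acos (x / r)) with (- acos (x / r) + 2 * INR 1 * PI) by (simpl; ring).
      rewrite cos_period, sin_period, cos_neg, sin_neg, hc, hs, Rabs_left by lra.
      f_equal; field; lra.
Qed.

Lemma closure_mem (U : R * R -> Prop) (x : R * R) : U x -> closure U x.
Proof. intros hx V hV. exists x. split; [now apply locally_singleton | exact hx]. Qed.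

Lemma polar_ray (V : R * R -> Prop) (r t : R) :
  locally (polar r t) V -> locally r (fun s => V (polar s t)).
Proof.
  intros hV.
  assert (h : continuous (fun s : R => polar s t) r).
  { apply (continuous_comp_2 (fun s : R => s) (fun _ : R => t) polar).
    - apply continuous_id.
    - apply continuous_const.
    - apply continuous_polar. }
  exact (h _ hV).
Qed.

Lemma closure_outward (U : R * R -> Prop) (r t : R) :
  at_right r (fun s => U (polar s t)) -> closure U (polar r t).
Proof.
  intros hU V hV.
  assert (h : at_right r (fun s => V (polar s t) /\ U (polar s t))).
  { apply filter_and; [| exact hU].
    apply (filter_le_within _). now apply polar_ray. }
  destruct (filter_ex _ h) as [s hs]. now exists (polar s t).
Qed.

Lemma closure_inward (U : R * R -> Prop) (r t : R) :
  at_left r (fun s => U (polar s t)) -> closure U (polar r t).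
Proof.
  intros hU V hV.
  assert (h : at_left r (fun s => V (polar s t) /\ U (polar s t))).
  { apply filter_and; [| exact hU].
    apply (filter_le_within _). now apply polar_ray. }
  destruct (filter_ex _ h) as [s hs]. now exists (polar s t).
Qed.

Lemma locally_enorm_gt (r : R) (x : R * R) : r < enorm x -> locally x (fun y => r < enorm y).
Proof. intros h. exact (continuous_enorm x _ (open_gt r _ h)). Qed.

Lemma locally_enorm_lt (r : R) (x : R * R) : enorm x < r -> locally x (fun y => enorm y < r).
Proof. intros h. exact (continuous_enorm x _ (open_lt r _ h)). Qed.

Lemma at_left_below (r : R) : at_left r (fun s => s < r).
Proof. unfold at_left, within. now apply filter_forall. Qed.

Lemma at_right_above (r : R) : at_right r (fun s => r < s).
Proof. unfold at_right, within. now apply filter_forall. Qed.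

Lemma at_left_gt (a r : R) : a < r -> at_left r (fun s => a < s).
Proof. intros h. apply (filter_le_within _). now apply open_gt. Qed.

Lemma at_right_lt (r a : R) : r < a -> at_right r (fun s => s < a).
Proof. intros h. apply (filter_le_within _). now apply open_lt. Qed.

Lemma closure_disk (r : R) (x : R * R) : 0 < r -> closure (disk r) x <-> enorm x <= r.
Proof.
  intros hr. split.
  - intros h. destruct (Rle_dec (enorm x) r) as [| n]; [assumption |].
    destruct (h _ (locally_enorm_gt r x ltac:(lra))) as [y [h1 h2]].
    unfold disk in h2. lra.
  - intros [h | h]; [now apply closure_mem |].
    destruct (polar_surjective x ltac:(lra)) as [t [_ <-]]. rewrite h.
    apply closure_inward.
    assert (hl := at_left_below r).
    generalize (filter_and _ _ hl (at_left_gt 0 r hr)). apply filter_imp.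
    intros s hs. unfold disk. rewrite enorm_polar; lra.
Qed.

Lemma exterior_disk (r : R) (x : R * R) : 0 < r -> exterior (disk r) x <-> r < enorm x.
Proof.
  intros hr. unfold exterior. rewrite closure_disk by assumption. split; lra.
Qed.

Lemma boundary_disk (r : R) (x : R * R) : 0 < r -> boundary (disk r) x <-> enorm x = r.
Proof.
  intros hr. unfold boundary. rewrite closure_disk by assumption. split.
  - intros [h1 h2]. destruct (Rle_dec r (enorm x)) as [| n]; [lra |].
    destruct (h2 _ (locally_enorm_lt r x ltac:(lra))) as [y [h3 h4]].
    now elim h4.
  - intros h. split; [lra |]. apply closure_mem. unfold disk. lra.
Qed.

(** For [y] at distance [q] from the boundary point [x] and [p = (y - x) . v], one has
    [|y|^2 = r^2 + 2 r p + q^2]. Once [q < 2 r eps], a slope [p < - eps q] outweighs [q^2]; for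
    [p > eps q] both corrections are nonnegative. *)
Lemma outward_normal_disk (r t : R) :
  0 < r -> outward_normal (disk r) (polar r t) (cos t, sin t).
Proof.
  intros hr. assert (hcs := sin2_cos2 t). unfold Rsqr in hcs.
  split.
  - replace (cos t, sin t) with (polar 1 t) by (unfold polar; f_equal; ring).
    apply enorm_polar; lra.
  - intros eps he.
    assert (hc : continuous (fun y => enorm (vsub y (polar r t))) (polar r t)).
    { apply (continuous_comp (fun y => vsub y (polar r t)) enorm).
      - apply (continuous_comp_2 (fun y : R * R => fst y - fst (polar r t))
          (fun y : R * R => snd y - snd (polar r t)) (fun x y => (x, y))).
        + apply continuous_Rplus; [apply continuous_fst | apply continuous_const].
        + apply continuous_Rplus; [apply continuous_snd | apply continuous_const].
        + apply (continuous_ext (fun z => z)); [now intros [] | apply continuous_id].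
      - apply continuous_enorm. }
    assert (h0 : enorm (vsub (polar r t) (polar r t)) < 2 * r * eps).
    { unfold vsub, enorm, dot; simpl. rewrite !Rminus_diag, Rmult_0_l, Rplus_0_l, sqrt_0.
      apply Rmult_lt_0_compat; lra. }
    generalize (hc _ (open_lt _ _ h0)). unfold filtermap. apply filter_imp.
    intros y hy.
    assert (hd := enorm_sqr (vsub y (polar r t))).
    assert (hn := enorm_nonneg (vsub y (polar r t))).
    assert (hsq := enorm_sqr y). assert (hny := enorm_nonneg y).
    set (q := enorm (vsub y (polar r t))) in *. set (w := enorm y) in *.
    destruct y as [y1 y2]. unfold dot, vsub, polar, disk in *; simpl in *. fold w.
    set (p := (y1 - r * cos t) * cos t + (y2 - r * sin t) * sin t).
    assert (e : w * w = r * r + 2 * r * p + q * q).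
    { rewrite hsq, hd. unfold p.
      replace (r * r) with (r * r * (sin t * sin t + cos t * cos t)) by (rewrite hcs; ring).
      ring. }
    clearbody p. split; intros hp.
    + assert (0 <= eps * q) by (apply Rmult_le_pos; lra).
      assert (2 * r * p < 2 * r * (- eps * q)) by (apply Rmult_lt_compat_l; lra).
      assert (q * q <= q * (2 * r * eps)) by (apply Rmult_le_compat_l; lra).
      apply Rnot_le_lt; intros hw.
      assert (r * r <= w * w) by (apply Rmult_le_compat; lra). lra.
    + intros hw.
      assert (0 <= eps * q) by (apply Rmult_le_pos; lra).
      assert (0 <= 2 * r * p) by (repeat apply Rmult_le_pos; lra).
      assert (0 <= q * q) by apply Rle_0_sqr.
      assert (w * w < r * r) by (apply Rmult_le_0_lt_compat; lra). lra.
Qed.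

(** * One-sided limits at a circle *)

(** The outward ray is one way of approaching [(r, t)] within [above r t]. A boundary condition
    stated along the normal thus determines the joint limit whose existence comes from
    regularity. *)
Lemma outward_limit_unique (f : R * R -> R) (r t l m : R) :
  filterlim f (above r t) (locally l) ->
  filterlim (fun s => f (r + s, t)) (at_right 0) (locally m) -> l = m.
Proof.
  intros hl hm.
  apply (filterlim_locally_unique (V := R_NormedModule) (F := at_right 0)
    (fun s => f (r + s, t))); [| exact hm].
  eapply filterlim_comp; [| exact hl].
  intros P [d hP]. exists d. intros s hs h0. apply hP; simpl; [| lra].
  split; simpl.
  - unfold ball in *; simpl in *; unfold AbsRing_ball, abs, minus, plus, opp in *; simpl in *.
    replace (r + s + - r) with (s + - 0) by ring. exact hs.
  - apply (ball_center (M := R_UniformSpace)).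
Qed.

Lemma inward_limit_unique (f : R * R -> R) (r t l m : R) :
  filterlim f (below r t) (locally l) ->
  filterlim (fun s => f (r - s, t)) (at_right 0) (locally m) -> l = m.
Proof.
  intros hl hm.
  apply (filterlim_locally_unique (V := R_NormedModule) (F := at_right 0)
    (fun s => f (r - s, t))); [| exact hm].
  eapply filterlim_comp; [| exact hl].
  intros P [d hP]. exists d. intros s hs h0. apply hP; simpl; [| lra].
  split; simpl.
  - unfold ball in *; simpl in *; unfold AbsRing_ball, abs, minus, plus, opp in *; simpl in *.
    replace (r - s + - r) with (- (s + - 0)) by ring. now rewrite Rabs_Ropp.
  - apply (ball_center (M := R_UniformSpace)).
Qed.

Lemma along_polar (r t s : R) : along (polar r t) s (cos t, sin t) = polar (r + s) t.
Proof. unfold along, polar; simpl; f_equal; ring. Qed.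

Lemma along_polar_opp (r t s : R) : along (polar r t) s (vopp (cos t, sin t)) = polar (r - s) t.
Proof. unfold along, polar, vopp; simpl; f_equal; ring. Qed.

Lemma part_dnu (b : bool) (u : R * R -> C) (r t : R) :
  part b (dnu u (cos t, sin t) (polar r t)) = trace_r b u (r, t).
Proof.
  unfold trace_r, trace, dnu, cdot, grad; simpl. destruct b; simpl; ring.
Qed.

Lemma side_limit_trace (b : bool) (u : R * R -> C) (r t : R) (l : C) :
  side_limit u (polar r t) (cos t, sin t) l ->
  filterlim (fun s => trace b u (r + s, t)) (at_right 0) (locally (part b l)).
Proof.
  intros h. apply (filterlim_ext (fun s => part b (u (along (polar r t) s (cos t, sin t))))).
  - intros s. now rewrite along_polar.
  - eapply filterlim_comp; [exact h | apply part_continuous].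
Qed.

Lemma side_limit_opp_trace (b : bool) (u : R * R -> C) (r t : R) (l : C) :
  side_limit u (polar r t) (vopp (cos t, sin t)) l ->
  filterlim (fun s => trace b u (r - s, t)) (at_right 0) (locally (part b l)).
Proof.
  intros h. apply (filterlim_ext (fun s => part b (u (along (polar r t) s (vopp (cos t, sin t)))))).
  - intros s. now rewrite along_polar_opp.
  - eapply filterlim_comp; [exact h | apply part_continuous].
Qed.

Lemma trace_dnu (b : bool) (u : R * R -> C) (r t : R) :
  trace b (dnu u (cos t, sin t)) (r, t) = trace_r b u (r, t).
Proof. apply part_dnu. Qed.

(** [Q] is a side of the circle in polar coordinates, which [polar] maps locally into [U]. The
    limits [l] and [m] are left unspecified; the interface conditions identify them afterwards. *)
Lemma C1_up_to_boundary_trace (U Q : R * R -> Prop) (u : R * R -> C) (b : bool) (r t : R) :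
  C1_up_to_boundary U u -> boundary U (polar r t) ->
  locally (r, t) (fun z : R * R => Q z -> U (polar (fst z) (snd z))) ->
  exists l m, filterlim (trace b u) (within Q (locally (r, t))) (locally l) /\
              filterlim (trace_r b u) (within Q (locally (r, t))) (locally m).
Proof.
  intros hu hb hQ. destruct (hu _ hb) as [l [l1 [l2 [h [h1 h2]]]]].
  assert (hp : forall v k, filterlim v (within U (locally (polar r t))) (locally k) ->
    filterlim (trace b v) (within Q (locally (r, t))) (locally (part b k))).
  { intros v k hv. unfold trace.
    apply (filterlim_comp _ _ _ (fun z : R * R => v (polar (fst z) (snd z))) (part b) _ (locally k));
      [| apply part_continuous].
    eapply filterlim_comp; [| exact hv].
    intros P hP. assert (hc := continuous_polar r t _ hP).
    unfold filtermap, within in *.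
    generalize (filter_and _ _ hQ hc). apply filter_imp.
    intros z [q1 q2] q3. apply q2, q1, q3. }
  exists (part b l), (part b l1 * cos t + part b l2 * sin t).
  split; [now apply hp |].
  assert (hs : filterlim (fun z : R * R => snd z) (within Q (locally (r, t))) (locally t)).
  { apply (filterlim_filter_le_1 _ (filter_le_within _)).
    apply (continuous_snd (U := R_UniformSpace) (V := R_UniformSpace)). }
  unfold trace_r.
  apply (filterlim_comp_2 (fun z => trace b (d1 u) z * cos (snd z))
    (fun z => trace b (d2 u) z * sin (snd z)) Rplus
    (G := locally (part b l1 * cos t)) (H := locally (part b l2 * sin t))).
  - apply filterlim_Rmult; [now apply hp |].
    eapply filterlim_comp; [exact hs | apply continuous_cos].
  - apply filterlim_Rmult; [now apply hp |].
    eapply filterlim_comp; [exact hs | apply continuous_sin].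
  - apply (filterlim_plus (K := R_AbsRing) (V := R_NormedModule)).
Qed.

Lemma boundary_exterior_disk (r t : R) :
  0 < r -> boundary (exterior (disk r)) (polar r t).
Proof.
  intros hr. split.
  - apply closure_outward.
    assert (hl := at_right_above r).
    revert hl. apply filter_imp. intros s hs. rewrite exterior_disk, enorm_polar; lra.
  - apply closure_mem. intros h. apply exterior_disk in h; [| exact hr].
    rewrite enorm_polar in h; lra.
Qed.

Lemma boundary_annulus_outer (r1 r2 t : R) :
  0 < r1 < r2 -> boundary (fun x => disk r2 x /\ exterior (disk r1) x) (polar r2 t).
Proof.
  intros hr. split.
  - apply closure_inward.
    assert (hl := at_left_below r2).
    generalize (filter_and _ _ hl (at_left_gt r1 r2 (proj2 hr))). apply filter_imp.
    intros s hs. rewrite exterior_disk by lra. unfold disk. rewrite enorm_polar; lra.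
  - apply closure_mem. intros [h _]. unfold disk in h. rewrite enorm_polar in h; lra.
Qed.

Lemma boundary_annulus_inner (r1 r2 t : R) :
  0 < r1 < r2 -> boundary (fun x => disk r2 x /\ exterior (disk r1) x) (polar r1 t).
Proof.
  intros hr. split.
  - apply closure_outward.
    assert (hl := at_right_above r1).
    generalize (filter_and _ _ hl (at_right_lt r1 r2 (proj2 hr))). apply filter_imp.
    intros s hs. rewrite exterior_disk by lra. unfold disk. rewrite enorm_polar; lra.
  - apply closure_mem. intros [_ h]. apply exterior_disk in h; [| lra].
    rewrite enorm_polar in h; lra.
Qed.

Lemma open_exterior_disk (r : R) : 0 < r -> open (exterior (disk r)).
Proof.
  intros hr x hx. apply exterior_disk in hx; [| exact hr].
  generalize (locally_enorm_gt r x hx). apply filter_imp.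
  intros y hy. now apply exterior_disk.
Qed.

Lemma open_exterior_disk_off (r1 r2 : R) :
  0 < r1 -> 0 < r2 -> open (fun x => exterior (disk r1) x /\ ~ boundary (disk r2) x).
Proof.
  intros h1 h2. apply open_and; [now apply open_exterior_disk |].
  intros x hx. rewrite boundary_disk in hx by exact h2.
  generalize (continuous_enorm x _ (open_neq r2 _ hx)). unfold filtermap.
  apply filter_imp. intros y hy. now rewrite boundary_disk.
Qed.

(** * The data as separated modes *)

(** Since [sin y = cos (y - PI / 2)], both parts of [expi] become a shifted cosine and share one
    family of modes. *)
Definition phase (b : bool) : R := if b then 0 else PI / 2.

Lemma part_0 (b : bool) : part b (RtoC 0) = 0.
Proof. now destruct b. Qed.

Lemma part_minus (b : bool) (y z : C) : part b (y - z)%C = part b y - part b z.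
Proof. destruct b; simpl; ring. Qed.

Lemma part_scal (b : bool) (x : R) (z : C) : part b (RtoC x * z)%C = x * part b z.
Proof. destruct b; simpl; ring. Qed.

Lemma part_expi (b : bool) (x y : R) :
  part b (RtoC x * expi y)%C = x * cos (y - phase b).
Proof.
  rewrite part_scal. f_equal. destruct b; simpl.
  - now rewrite Rminus_0_r.
  - replace (y - PI / 2) with (- (PI / 2 - y)) by ring.
    now rewrite cos_neg, cos_shift.
Qed.

Lemma filterlim_Rminus {T : Type} {F : (T -> Prop) -> Prop} {FF : Filter F}
    (f g : T -> R) (l m : R) :
  filterlim f F (locally l) -> filterlim g F (locally m) ->
  filterlim (fun x => f x - g x) F (locally (l - m)).
Proof.
  intros hf hg.
  apply (filterlim_comp_2 f (fun x => - g x) Rplus hf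
    (filterlim_comp _ _ _ g Ropp _ _ _ hg (filterlim_opp (K := R_AbsRing) (V := R_NormedModule) m))).
  apply (filterlim_plus (K := R_AbsRing) (V := R_NormedModule)).
Qed.

Lemma filterlim_within_continuous (f : R * R -> R) (Q : R * R -> Prop) (z : R * R) :
  continuous f z -> filterlim f (within Q (locally z)) (locally (f z)).
Proof. apply filterlim_filter_le_1, (filter_le_within _). Qed.

(** Only [A] is dictated by the behaviour at infinity: the [B] term is itself [O(1/r)] and goes into
    the constant. *)
Lemma asymptotic_trace (b : bool) (u v : R * R -> C) (n : nat) (d A B : R) :
  (1 <= n)%nat -> asymptotic_to u v ->
  (forall r t, 0 <= r -> part b (v (polar r t)) = A * r ^ n * cos (INR n * t - d)) ->
  exists M R0, forall r t, R0 <= r ->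
    Rabs (trace b u (r, t) - mode n d A B (r, t)) <= M / r.
Proof.
  intros hn [M [R0 [hR0 h]]] hv.
  exists (M + Rabs B), (Rmax R0 1). intros r t hr.
  assert (h1 := Rmax_l R0 1). assert (h2 := Rmax_r R0 1).
  assert (k1 := h (polar r t)). rewrite enorm_polar in k1 by lra.
  assert (k2 := part_le_Cmod b (u (polar r t) - v (polar r t))%C).
  assert (k3 := k1 ltac:(lra)).
  assert (k4 := radial_bound n B r hn ltac:(lra)).
  assert (e : trace b u (r, t) - mode n d A B (r, t) =
    part b (u (polar r t) - v (polar r t))%C - radial n 0 B r * cos (INR n * t - d)).
  { unfold trace, mode; simpl.
    rewrite part_minus, hv by lra. unfold radial. ring. }
  rewrite e. eapply Rle_trans; [apply Rabs_triang |].
  rewrite Rabs_Ropp, Rabs_mult.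
  assert (hcos : Rabs (cos (INR n * t - d)) <= 1)
    by (apply Rabs_le; generalize (COS_bound (INR n * t - d)); lra).
  assert (k5 : Rabs (radial n 0 B r) * Rabs (cos (INR n * t - d)) <= Rabs B / r * 1)
    by (apply Rmult_le_compat; auto using Rabs_pos).
  replace ((M + Rabs B) / r) with (M / r + Rabs B / r * 1) by (field; lra).
  lra.
Qed.

Lemma pow_double (x : R) (n : nat) : x ^ (2 * n) = x ^ n * x ^ n.
Proof. rewrite <- pow_add. f_equal; lia. Qed.

(** * Identification of the potential and the pressure for concentric disks *)

Section Disks.
Variables (ri re : R) (n : nat) (H P : R * R -> C) (zeta0 : R) (phi p : R * R -> C).
Hypotheses (hri : 0 < ri) (hre : ri < re) (hn : (1 <= n)%nat).
Hypothesis hH : forall r th : R, 0 <= r ->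
  H (polar r th) = (RtoC (r ^ n) * expi (INR n * th))%C.
Hypothesis hP : forall r th : R, 0 <= r ->
  P (polar r th) = (RtoC (12 * r ^ n) * expi (INR n * th))%C.
Hypothesis hsol : electroosmotic_solution (disk ri) (disk re) H P zeta0 phi p.
Variable b : bool.

Let d := phase b.
Let rho := ri ^ (2 * n).
Let s := re ^ (2 * n).

Lemma rho_sqrt : rho = ri ^ n * ri ^ n.
Proof. apply pow_double. Qed.

(** Up to the factor [INR n / ri], this is the radial derivative of [radial n A (A * rho)] at [ri]:
    the Neumann condition fixes the ratio of the two coefficients to be [rho]. *)
Lemma neumann_coefficient (A : R) : radial n A (- (A * rho)) ri = 0.
Proof.
  assert (h := pow_lt ri n hri). unfold radial. rewrite rho_sqrt. field. lra.
Qed.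

Lemma mode_r_inner (A t : R) : mode_r n d A (A * rho) (ri, t) = 0.
Proof.
  unfold mode_r; simpl. rewrite neumann_coefficient. unfold Rdiv; ring.
Qed.

Lemma mode_continuous (A B r t : R) : r <> 0 -> continuous (mode n d A B) (r, t).
Proof. intros hr. now apply (ph_cont _ _ _ _ _ (mode_harmonic n d A B r hr)). Qed.

Lemma mode_r_continuous (A B r t : R) : r <> 0 -> continuous (mode_r n d A B) (r, t).
Proof. intros hr. now apply (ph_cont_r _ _ _ _ _ (mode_harmonic n d A B r hr)). Qed.

Lemma phi_polar :
  polar_harmonic (fun r => ri < r) (trace b phi) (trace_r b phi) (trace_t b phi) (trace_tt b phi).
Proof.
  apply (harmonic_polar (exterior (disk ri)) (open_exterior_disk ri hri) b).
  - intros r t hr. rewrite exterior_disk, enorm_polar; lra.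
  - intros r hr. lra.
  - apply (phi_harmonic _ _ _ _ _ _ _ hsol).
Qed.

(** The coefficient 1 comes from [H] at infinity and [rho] from the Neumann condition. Placing the
    interface at [r + 1] keeps the radius of interest off it. *)
Lemma phi_mode (r t : R) : ri < r -> trace b phi (r, t) = mode n d 1 rho (r, t).
Proof.
  intros hr. apply Rminus_diag_uniq.
  set (V := fun z => trace b phi z - mode n d 1 rho z).
  set (Vr := fun z => trace_r b phi z - mode_r n d 1 rho z).
  assert (hV : polar_harmonic (fun r => ri < r) V Vr
    (fun z => trace_t b phi z - mode_t n d 1 rho z)
    (fun z => trace_tt b phi z - mode_tt n d 1 rho z)).
  { apply polar_harmonic_minus; [apply phi_polar | | intros; lra].
    apply polar_harmonic_local.
    - intros q hq. do 4 eexists. split; [apply mode_harmonic; lra |].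
      apply filter_forall. auto.
    - apply (ph_per _ _ _ _ _ (mode_harmonic n d 1 rho 1 R1_neq_R0)).
    - apply (ph_per_t _ _ _ _ _ (mode_harmonic n d 1 rho 1 R1_neq_R0)). }
  (* [phi] solves the transmission problem with any fictitious interface. *)
  apply (transmission_unique ri (r + 1) V Vr
    (fun z => trace_t b phi z - mode_t n d 1 rho z)
    (fun z => trace_tt b phi z - mode_tt n d 1 rho z)).
  - lra.
  - revert hV. apply polar_harmonic_sub. intros q hq; apply hq.
  - intros q.
    destruct (C1_up_to_boundary_trace (exterior (disk ri)) (fun z => ri < fst z) phi b ri q
      (phi_regular _ _ _ _ _ _ _ hsol) (boundary_exterior_disk ri q hri)) as [l [m [h1 h2]]].
    { apply filter_forall. intros z hz. rewrite exterior_disk, enorm_polar; lra. }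
    assert (hm : m = 0).
    { apply (outward_limit_unique (trace_r b phi) ri q); [exact h2 |].
      assert (hb : boundary (disk ri) (polar ri q))
        by (apply boundary_disk; [exact hri | apply enorm_polar; lra]).
      assert (hs := side_limit_trace b _ _ _ _ (phi_neumann _ _ _ _ _ _ _ hsol _ _ hb
        (outward_normal_disk ri q hri))).
      replace (part b (RtoC 0)) with 0 in hs by (symmetry; apply part_0).
      revert hs. apply filterlim_ext. intros x. apply trace_dnu. }
    exists (l - mode n d 1 rho (ri, q)). split.
    + apply filterlim_Rminus; [exact h1 |].
      apply filterlim_within_continuous, mode_continuous. lra.
    + replace 0 with (m - mode_r n d 1 rho (ri, q))
        by (rewrite <- (Rmult_1_l rho), mode_r_inner; lra).
      apply filterlim_Rminus; [exact h2 |].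
      apply filterlim_within_continuous, mode_r_continuous. lra.
  - intros q. exists (V (r + 1, q)).
    split; apply filterlim_within_continuous; apply (ph_cont _ _ _ _ _ hV); lra.
  - intros q. exists (Vr (r + 1, q)).
    split; apply filterlim_within_continuous; apply (ph_cont_r _ _ _ _ _ hV); lra.
  - apply (asymptotic_trace b phi H); [exact hn | apply (phi_infinity _ _ _ _ _ _ _ hsol) |].
    intros q th hq. rewrite hH by exact hq. rewrite part_expi. unfold d. ring.
  - split; lra.
Qed.

Lemma phi_mode_r (r t : R) : ri < r -> trace_r b phi (r, t) = mode_r n d 1 rho (r, t).
Proof.
  intros hr.
  rewrite <- (is_derive_unique _ _ _ (ph_r _ _ _ _ _ phi_polar r t hr)).
  apply is_derive_unique.
  apply (is_derive_ext_loc (fun q : R => mode n d 1 rho (q, t))).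
  - generalize (open_gt ri r hr). apply filter_imp. intros q hq. symmetry. now apply phi_mode.
  - assert (h0 : r <> 0) by lra.
    now apply (ph_r _ _ _ _ _ (mode_harmonic n d 1 rho r h0)).
Qed.

(** The two interface conditions at [re] form a linear system for the coefficient
    [c_in] of [r ^ n] inside and the coefficient [c_out] of [r ^ -n] outside. *)
Definition c_in : R := 12 - 6 * zeta0 * (s - rho) / s.
Definition c_out : R := c_in * (s + rho) - 12 * s.
(** [transmission_unique] asks for a single function on both sides of [re], so the coefficients
    switch with the radius. Off [re] they are locally constant, which suits
    [polar_harmonic_local]. *)
Definition coef_A (r : R) : R := if Rlt_dec r re then c_in else 12.
Definition coef_B (r : R) : R := if Rlt_dec r re then c_in * rho else c_out.

Lemma coef_inside (r : R) : r < re -> coef_A r = c_in /\ coef_B r = c_in * rho.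
Proof. intros h. unfold coef_A, coef_B. destruct (Rlt_dec r re); [easy | lra]. Qed.

Lemma coef_outside (r : R) : re < r -> coef_A r = 12 /\ coef_B r = c_out.
Proof. intros h. unfold coef_A, coef_B. destruct (Rlt_dec r re); [lra | easy]. Qed.

Definition p_mode (z : R * R) : R := mode n d (coef_A (fst z)) (coef_B (fst z)) z.
Definition p_mode_r (z : R * R) : R := mode_r n d (coef_A (fst z)) (coef_B (fst z)) z.
Definition p_mode_t (z : R * R) : R := mode_t n d (coef_A (fst z)) (coef_B (fst z)) z.
Definition p_mode_tt (z : R * R) : R := mode_tt n d (coef_A (fst z)) (coef_B (fst z)) z.

Lemma p_mode_harmonic : polar_harmonic (off_circles ri re) p_mode p_mode_r p_mode_t p_mode_tt.
Proof.
  apply polar_harmonic_local.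
  - intros r [h1 h2]. exists (mode n d (coef_A r) (coef_B r)),
      (mode_r n d (coef_A r) (coef_B r)), (mode_t n d (coef_A r) (coef_B r)),
      (mode_tt n d (coef_A r) (coef_B r)).
    split; [apply mode_harmonic; lra |].
    unfold p_mode, p_mode_r, p_mode_t, p_mode_tt; simpl.
    destruct (Rlt_dec r re) as [h | h].
    + generalize (open_lt re r h). apply filter_imp. intros q hq t.
      destruct (coef_inside r h) as [-> ->]. now destruct (coef_inside q hq) as [-> ->].
    + assert (h' : re < r) by lra.
      generalize (open_gt re r h'). apply filter_imp. intros q hq t.
      destruct (coef_outside r h') as [-> ->]. now destruct (coef_outside q hq) as [-> ->].
  - intros r t.
    apply (ph_per _ _ _ _ _ (mode_harmonic n d (coef_A r) (coef_B r) 1 R1_neq_R0)).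
  - intros r t.
    apply (ph_per_t _ _ _ _ _ (mode_harmonic n d (coef_A r) (coef_B r) 1 R1_neq_R0)).
Qed.

Lemma p_polar :
  polar_harmonic (off_circles ri re) (trace b p) (trace_r b p) (trace_t b p) (trace_tt b p).
Proof.
  apply (harmonic_polar (fun x => exterior (disk ri) x /\ ~ boundary (disk re) x)
    (open_exterior_disk_off ri re hri ltac:(lra)) b).
  - intros r t [h1 h2]. rewrite exterior_disk, boundary_disk, enorm_polar; lra.
  - intros r [h1 h2]. lra.
  - apply (p_harmonic _ _ _ _ _ _ _ hsol).
Qed.

Lemma filterlim_above_mode (t : R) :
  filterlim p_mode (above re t) (locally (mode n d 12 c_out (re, t))) /\
  filterlim p_mode_r (above re t) (locally (mode_r n d 12 c_out (re, t))).
Proof.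
  split.
  - apply (filterlim_within_ext _ (mode n d 12 c_out)).
    + intros z hz. unfold p_mode. now destruct (coef_outside (fst z) hz) as [-> ->].
    + apply filterlim_within_continuous, mode_continuous. lra.
  - apply (filterlim_within_ext _ (mode_r n d 12 c_out)).
    + intros z hz. unfold p_mode_r. now destruct (coef_outside (fst z) hz) as [-> ->].
    + apply filterlim_within_continuous, mode_r_continuous. lra.
Qed.

Lemma filterlim_below_mode (t : R) :
  filterlim p_mode (below re t) (locally (mode n d c_in (c_in * rho) (re, t))) /\
  filterlim p_mode_r (below re t) (locally (mode_r n d c_in (c_in * rho) (re, t))).
Proof.
  split.
  - apply (filterlim_within_ext _ (mode n d c_in (c_in * rho))).
    + intros z hz. unfold p_mode. now destruct (coef_inside (fst z) hz) as [-> ->].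
    + apply filterlim_within_continuous, mode_continuous. lra.
  - apply (filterlim_within_ext _ (mode_r n d c_in (c_in * rho))).
    + intros z hz. unfold p_mode_r. now destruct (coef_inside (fst z) hz) as [-> ->].
    + apply filterlim_within_continuous, mode_r_continuous. lra.
Qed.

Lemma filterlim_inner_mode (t : R) :
  filterlim p_mode (above ri t) (locally (mode n d c_in (c_in * rho) (ri, t))) /\
  filterlim p_mode_r (above ri t) (locally 0).
Proof.
  assert (hl : above ri t (fun z => fst z < re))
    by (apply (filter_le_within _); exact (locally_fst _ ri t (open_lt re ri hre))).
  split.
  - apply (filterlim_ext_loc (mode n d c_in (c_in * rho))).
    + revert hl. apply filter_imp. intros z hz. unfold p_mode.
      now destruct (coef_inside (fst z) hz) as [-> ->].
    + apply filterlim_within_continuous, mode_continuous. lra.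
  - rewrite <- (mode_r_inner c_in t).
    apply (filterlim_ext_loc (mode_r n d c_in (c_in * rho))).
    + revert hl. apply filter_imp. intros z hz. unfold p_mode_r.
      now destruct (coef_inside (fst z) hz) as [-> ->].
    + apply filterlim_within_continuous, mode_r_continuous. lra.
Qed.

(** Multiplied by [re^n], the radial factors give [12 s + c_out = c_in (s + rho)], which is how
    [c_out] was chosen. *)
Lemma mode_continuity (t : R) :
  mode n d 12 c_out (re, t) = mode n d c_in (c_in * rho) (re, t).
Proof.
  unfold mode; simpl. f_equal. unfold radial, c_out, s. rewrite pow_double.
  assert (h : 0 < re ^ n) by (apply pow_lt; lra). field. lra.
Qed.

(** Without the common factor [n cos (n t - d) / re] and multiplied by [re^n], this reads [12 s -
    c_out - c_in (s - rho) = 12 zeta0 (s - rho)]. Eliminating [c_out] by continuity gives the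
    formula for [c_in]. *)
Lemma mode_jump (t : R) :
  mode_r n d 12 c_out (re, t) - mode_r n d c_in (c_in * rho) (re, t) =
  12 * zeta0 * mode_r n d 1 rho (re, t).
Proof.
  unfold mode_r; simpl. unfold radial, c_out, c_in, s. rewrite pow_double.
  assert (h : 0 < re ^ n) by (apply pow_lt; lra). field. lra.
Qed.

Lemma p_trace_mode (r t : R) : off_circles ri re r -> trace b p (r, t) = p_mode (r, t).
Proof.
  intros hr. apply Rminus_diag_uniq.
  assert (hre0 : 0 < re) by lra.
  set (V := fun z => trace b p z - p_mode z).
  set (Vr := fun z => trace_r b p z - p_mode_r z).
  assert (hV : polar_harmonic (off_circles ri re) V Vr
    (fun z => trace_t b p z - p_mode_t z) (fun z => trace_tt b p z - p_mode_tt z)).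
  { apply polar_harmonic_minus; [apply p_polar | apply p_mode_harmonic |].
    intros q [hq _]; lra. }
  (* Regularity on each side yields joint limits; continuity and jump along the normal then identify
     them, the known derivative of [phi] giving the size of the jump. *)
  assert (hlim : forall q, exists l lp lm,
    filterlim (trace b p) (above re q) (locally l) /\
    filterlim (trace b p) (below re q) (locally l) /\
    filterlim (trace_r b p) (above re q) (locally lp) /\
    filterlim (trace_r b p) (below re q) (locally lm) /\
    lp - lm = 12 * zeta0 * mode_r n d 1 rho (re, q)).
  { intros q.
    assert (hb : boundary (disk re) (polar re q))
      by (apply boundary_disk; [exact hre0 | apply enorm_polar; lra]).
    assert (hv := outward_normal_disk re q hre0).
    destruct (C1_up_to_boundary_trace (exterior (disk re)) (fun z => re < fst z) p b re q
      (p_regular_out _ _ _ _ _ _ _ hsol) (boundary_exterior_disk re q hre0))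
      as [lp [mp [h1 h2]]].
    { apply filter_forall. intros z hz. rewrite exterior_disk, enorm_polar; lra. }
    destruct (C1_up_to_boundary_trace (fun x => disk re x /\ exterior (disk ri) x)
      (fun z => fst z < re) p b re q
      (p_regular_in _ _ _ _ _ _ _ hsol) (boundary_annulus_outer ri re q (conj hri hre)))
      as [lm [mm [h3 h4]]].
    { generalize (locally_fst _ re q (open_gt ri re hre)). apply filter_imp.
      intros z hz hz'. rewrite exterior_disk by lra. unfold disk. rewrite enorm_polar; lra. }
    destruct (p_continuity _ _ _ _ _ _ _ hsol _ _ hb hv) as [k [k1 k2]].
    destruct (p_jump _ _ _ _ _ _ _ hsol _ _ hb hv) as [jp [jm [j1 [j2 j3]]]].
    assert (e1 : lp = part b k)
      by (apply (outward_limit_unique _ _ _ _ _ h1); now apply side_limit_trace).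
    assert (e2 : lm = part b k)
      by (apply (inward_limit_unique _ _ _ _ _ h3); now apply side_limit_opp_trace).
    assert (e3 : mp = part b jp).
    { apply (outward_limit_unique _ _ _ _ _ h2).
      generalize (side_limit_trace b _ _ _ _ j1). apply filterlim_ext.
      intros x. apply trace_dnu. }
    assert (e4 : mm = part b jm).
    { apply (inward_limit_unique _ _ _ _ _ h4).
      generalize (side_limit_opp_trace b _ _ _ _ j2). apply filterlim_ext.
      intros x. apply trace_dnu. }
    exists (part b k), mp, mm. rewrite <- e1 at 1. rewrite <- e2.
    repeat (split; [assumption |]).
    rewrite <- phi_mode_r by exact hre. rewrite <- part_dnu.
    rewrite e3, e4.
    now rewrite <- part_minus, j3, part_scal. }
  apply (transmission_unique ri re V Vr (fun z => trace_t b p z - p_mode_t z)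
    (fun z => trace_tt b p z - p_mode_tt z)).
  - lra.
  - exact hV.
  - intros q. destruct (filterlim_inner_mode q) as [f1 f2].
    destruct (C1_up_to_boundary_trace (fun x => disk re x /\ exterior (disk ri) x)
      (fun z => ri < fst z) p b ri q
      (p_regular_in _ _ _ _ _ _ _ hsol) (boundary_annulus_inner ri re q (conj hri hre)))
      as [l [m [h1 h2]]].
    { generalize (locally_fst _ ri q (open_lt re ri hre)). apply filter_imp.
      intros z hz hz'. rewrite exterior_disk by lra. unfold disk. rewrite enorm_polar; lra. }
    assert (hm : m = 0).
    { apply (outward_limit_unique (trace_r b p) ri q); [exact h2 |].
      assert (hb : boundary (disk ri) (polar ri q))
        by (apply boundary_disk; [exact hri | apply enorm_polar; lra]).
      assert (hs := side_limit_trace b _ _ _ _ (p_neumann _ _ _ _ _ _ _ hsol _ _ hb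
        (outward_normal_disk ri q hri))).
      replace (part b (RtoC 0)) with 0 in hs by (symmetry; apply part_0).
      revert hs. apply filterlim_ext. intros x. apply trace_dnu. }
    subst m.
    eexists; split; [apply filterlim_Rminus; eassumption |].
    rewrite <- (Rminus_diag 0). now apply filterlim_Rminus.
  - intros q. destruct (hlim q) as [l [lp [lm [h1 [h2 _]]]]].
    destruct (filterlim_above_mode q) as [f1 _]. destruct (filterlim_below_mode q) as [f2 _].
    rewrite <- mode_continuity in f2.
    eexists; split; apply filterlim_Rminus; eassumption.
  - intros q. destruct (hlim q) as [l [lp [lm [_ [_ [h1 [h2 h3]]]]]]].
    destruct (filterlim_above_mode q) as [_ f1]. destruct (filterlim_below_mode q) as [_ f2].
    (* [trace_r b p] and [p_mode_r] jump by the same amount, so their difference has one common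
       limit from both sides. *)
    assert (e := mode_jump q).
    exists (lp - mode_r n d 12 c_out (re, q)). split; [now apply filterlim_Rminus |].
    replace (lp - mode_r n d 12 c_out (re, q))
      with (lm - mode_r n d c_in (c_in * rho) (re, q)) by lra.
    now apply filterlim_Rminus.
  - destruct (asymptotic_trace b p P n d 12 c_out hn (p_infinity _ _ _ _ _ _ _ hsol))
      as [M [R0 hM]].
    { intros q th hq. rewrite hP by exact hq. now rewrite part_expi. }
    (* Beyond [re + 1] the outer coefficients are in force. *)
    exists M, (Rmax R0 (re + 1)). intros q th hq.
    assert (m1 := Rmax_l R0 (re + 1)). assert (m2 := Rmax_r R0 (re + 1)).
    unfold V, p_mode; simpl. destruct (coef_outside q ltac:(lra)) as [e1 e2]. rewrite e1, e2.
    apply hM. lra.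
  - exact hr.
Qed.

End Disks.

(** * The circle by arc length, and the force on it *)

Lemma circle_arclength (r : R) :
  0 < r -> arclength_parametrization (disk r) (fun s => polar r (s / r)) (2 * PI * r).
Proof.
  intros hr. assert (hPI := PI_RGT_0).
  split; [apply Rmult_lt_0_compat; lra |].
  split; [| split; [| split]].
  - exists (fun s => (- sin (s / r), cos (s / r))). intros s. split; [| split].
    + assert (h1 : is_derive (fun s => r * cos (s / r)) s (- sin (s / r)))
        by (auto_derive; [exact I | unfold Rdiv; field; lra]).
      assert (h2 : is_derive (fun s => r * sin (s / r)) s (cos (s / r)))
        by (auto_derive; [exact I | unfold Rdiv; field; lra]).
      apply (filterdiff_comp'_2 (K := R_AbsRing) (T := R_NormedModule) (U := R_NormedModule)
        (V := R_NormedModule) (W := prod_NormedModule _ R_NormedModule R_NormedModule)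
        (fun s => r * cos (s / r)) (fun s => r * sin (s / r)) (fun x y => (x, y)) s
        (fun y => scal y (- sin (s / r))) (fun y => scal y (cos (s / r))) (fun x y => (x, y)));
        [exact h1 | exact h2 |].
      apply (filterdiff_ext (fun z => z)); [now intros [] |].
      apply (filterdiff_ext_lin _ (fun z => z)); [apply filterdiff_id | now intros []].
    + apply (continuous_comp_2 (fun s => - sin (s / r)) (fun s => cos (s / r)) (fun x y => (x, y))).
      * apply (ex_derive_continuous (V := R_NormedModule)); auto_derive; exact I.
      * apply (ex_derive_continuous (V := R_NormedModule)); auto_derive; exact I.
      * apply (continuous_ext (fun z => z)); [now intros [] | apply continuous_id].
    + unfold enorm, dot; simpl. rewrite <- sqrt_1. f_equal.
      assert (h := sin2_cos2 (s / r)). unfold Rsqr in h. lra.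
  - intros s. rewrite <- (polar_period r (s / r)). f_equal. field. lra.
  - intros s t hs ht e.
    assert (e1 : cos (s / r) = cos (t / r))
      by (apply (f_equal fst) in e; simpl in e; apply Rmult_eq_reg_l in e; lra).
    assert (e2 : sin (s / r) = sin (t / r))
      by (apply (f_equal snd) in e; simpl in e; apply Rmult_eq_reg_l in e; lra).
    assert (bound : forall x, 0 <= x < 2 * PI * r -> 0 <= x / r < 2 * PI).
    { intros x hx. split; [apply Rdiv_le_0_compat; lra | apply Rlt_div_l; lra]. }
    assert (b1 := bound s hs). assert (b2 := bound t ht).
    (* Equal sines and cosines give [cos (2 w) = 1], hence [sin w = 0]; as both angles lie in
       [[0, 2 PI)], [w] lies strictly between [- PI] and [PI] and must vanish. *)
    set (w := (s / r - t / r) / 2).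
    assert (h0 : sin w = 0).
    { assert (hc : cos (s / r - t / r) = 1).
      { rewrite cos_minus, e1, e2. assert (h := sin2_cos2 (t / r)). unfold Rsqr in h. lra. }
      replace (s / r - t / r) with (2 * w) in hc by (unfold w; field; lra).
      rewrite cos_2a_sin in hc. apply Rsqr_0_uniq. unfold Rsqr. lra. }
    assert (hw : w = 0).
    { destruct (Rtotal_order w 0) as [h | [h | h]]; [| exact h |].
      - assert (k := sin_gt_0 (- w)). rewrite sin_neg in k. unfold w in *. lra.
      - assert (k := sin_gt_0 w). unfold w in *. lra. }
    assert (e3 : s / r = t / r) by (unfold w in hw; lra).
    apply (f_equal (Rmult r)) in e3. field_simplify in e3; lra.
  - intros x. rewrite boundary_disk by exact hr. split.
    + intros hx. destruct (polar_surjective x ltac:(lra)) as [t [ht e]].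
      rewrite hx in e. exists (r * t). split.
      * split; [apply Rmult_le_pos; lra |].
        rewrite Rmult_comm. apply Rmult_lt_compat_r; lra.
      * rewrite <- e. f_equal. field. lra.
    + intros [s [_ <-]]. apply enorm_polar. lra.
Qed.

Lemma pow_lt_pow (x y : R) (n : nat) : 0 <= x < y -> (1 <= n)%nat -> x ^ n < y ^ n.
Proof.
  intros hxy hn. destruct n as [| n]; [lia |]. clear hn.
  induction n as [| n IH]; [simpl; lra |].
  change (x * x ^ S n < y * y ^ S n).
  apply Rmult_le_0_lt_compat; try lra. apply pow_le; lra.
Qed.

(** The trace on the circle is a limit from outside, so a pressure vanishing on a surrounding
    annulus has zero trace and zero traction at every point. *)
Lemma force_zero (r : R) (p : R * R -> C) :
  0 < r ->
  (exists r', r < r' /\ forall x, r < enorm x < r' -> p x = RtoC 0) ->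
  is_hydrodynamic_force (disk r) p (RtoC 0, RtoC 0).
Proof.
  intros hr [r' [hr' hp]].
  exists (fun s => polar r (s / r)), (2 * PI * r),
    (fun x => (fst x / r, snd x / r)), (fun _ => RtoC 0).
  split; [now apply circle_arclength |]. split.
  - intros x hx. apply boundary_disk in hx; [| exact hr].
    destruct (polar_surjective x ltac:(lra)) as [t [_ <-]]. rewrite hx.
    replace (fst (polar r t) / r, snd (polar r t) / r) with (cos t, sin t)
      by (unfold polar; simpl; f_equal; field; lra).
    split; [now apply outward_normal_disk |].
    unfold side_limit. apply (filterlim_ext_loc (fun _ => RtoC 0)); [| apply filterlim_const].
    exists (mkposreal (r' - r) ltac:(lra)). intros s hs hs0. symmetry. apply hp.
    rewrite along_polar, enorm_polar by lra.
    unfold ball in hs; simpl in hs; unfold AbsRing_ball, abs, minus, plus, opp in hs; simpl in hs.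
    apply Rabs_def2 in hs. lra.
  - simpl.
    assert (h1 : is_RInt (V := C_R_NormedModule) (fun _ => RtoC 0) 0 (2 * PI * r) (RtoC 0)).
    { refine (eq_ind _ (is_RInt (V := C_R_NormedModule) (fun _ => RtoC 0) 0 (2 * PI * r))
        (is_RInt_const (V := C_R_NormedModule) 0 (2 * PI * r) (RtoC 0)) _ _).
      apply (scal_zero_r (V := C_R_NormedModule)). }
    split; revert h1; apply is_RInt_ext; intros s _; unfold cdot; simpl; ring.
Qed.

Theorem theorem2p1 (ri re : R) (hri : 0 < ri) (hre : ri < re)
    (n : nat) (hn : (1 <= n)%nat) (H P : R * R -> C)
    (hH : forall r th : R, 0 <= r ->
       H (polar r th) = (RtoC (r ^ n) * expi (INR n * th))%C)
    (hP : forall r th : R, 0 <= r ->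
       P (polar r th) = (RtoC (12 * r ^ n) * expi (INR n * th))%C)
    (zeta0 : R) (phi p : R * R -> C)
    (hsol : electroosmotic_solution (disk ri) (disk re) H P zeta0 phi p) :
  (zeta0 = 2 * ri ^ (2 * n) * re ^ (2 * n) / (re ^ (4 * n) - ri ^ (4 * n)) ->
     perfect_hydrodynamic_cloaking (disk ri) (disk re) zeta0 P phi p) /\
  (zeta0 = 2 * re ^ (2 * n) / (re ^ (2 * n) - ri ^ (2 * n)) ->
     perfect_hydrodynamic_shielding (disk ri) p).
Proof.
  assert (hp := p_trace_mode ri re n H P zeta0 phi p hri hre hn hH hP hsol).
  assert (hrho : 0 < ri ^ (2 * n)) by now apply pow_lt.
  assert (hs : ri ^ (2 * n) < re ^ (2 * n)) by (apply pow_lt_pow; [lra | lia]).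
  split; intros hz.
  - assert (hc : c_out ri re n zeta0 = 0).
    (* The denominator becomes [s^2 - rho^2] in terms of the quantities that enter [c_out]. *)
    { replace (4 * n)%nat with (2 * (2 * n))%nat in hz by lia.
      rewrite !(pow_double _ (2 * n)) in hz.
      unfold c_out, c_in. rewrite hz. field. split; nra. }
    assert (e : forall x, re < enorm x -> p x = P x).
    { intros x hx. destruct (polar_surjective x ltac:(lra)) as [t [_ <-]].
      apply part_ext. intros b.
      assert (h := hp b (enorm x) t ltac:(split; lra)). unfold trace in h; simpl in h.
      rewrite h, hP by lra. rewrite part_expi. unfold p_mode, mode, radial; simpl.
      destruct (coef_outside ri re n zeta0 _ hx) as [-> ->]. rewrite hc.
      unfold Rdiv. ring. }
    intros x hx. apply exterior_disk in hx; [| lra].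
    assert (hl := locally_enorm_gt re x hx).
    (* The exterior is open, so agreement of [p] and [P] there holds near [x] and passes to the
       partial derivatives. *)
    assert (e1 : d1 p x = d1 P x).
    { destruct hl as [d hd].
      unfold d1; f_equal; apply Derive_ext_loc; exists d; intros s h; rewrite e; try reflexivity;
        apply hd; (split; [exact h | apply (ball_center (M := R_UniformSpace))]). }
    assert (e2 : d2 p x = d2 P x).
    { destruct hl as [d hd].
      unfold d2; f_equal; apply Derive_ext_loc; exists d; intros s h; rewrite e; try reflexivity;
        apply hd; (split; [apply (ball_center (M := R_UniformSpace)) | exact h]). }
    unfold u_aver, zeta_mean.
    (* Outside [Omega] the zeta potential is 0, and only the pressure term of the velocity
       remains. *)
    destruct (excluded_middle_informative _) as [[h _] | _]; [unfold disk in h; lra |].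
    rewrite e1, e2.
    assert (alg : forall y z : C,
      (RtoC (- (1 / 12)) * y - RtoC 0 * z)%C = (- y / RtoC 12)%C).
    { intros [] []. apply injective_projections; simpl; field. }
    now rewrite !alg.
  (* Both inner coefficients, [c_in] and [c_in * rho], vanish together, so the pressure is zero
     throughout the annulus and not merely of zero mean on the circle. *)
  - assert (hc : c_in ri re n zeta0 = 0) by (unfold c_in; rewrite hz; field; lra).
    apply force_zero; [exact hri |].
    exists re. split; [exact hre |]. intros x hx.
    destruct (polar_surjective x ltac:(lra)) as [t [_ <-]].
    apply part_ext. intros b. rewrite part_0.
    assert (h := hp b (enorm x) t ltac:(split; lra)). unfold trace in h; simpl in h.
    rewrite h. unfold p_mode, mode, radial; simpl.
    destruct (coef_inside ri re n zeta0 _ (proj2 hx)) as [-> ->]. rewrite hc.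
    unfold Rdiv. ring.
Qed.
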